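(* Let $K$ be a finite field extension of $\mathbb{Q}_p$ with valuation ring $R$. Let $f=(f_1,\ldots,f_r)$ be a dominant polynomial map with $f_i\in K[x]$, $x=(x_1,\ldots,x_n)$, and for a Schwartz–Bruhat function $\phi:K^n\to\mathbb{Q}$ and $y\in K^r$ put $$E_\phi(y)=\int_{K^n}\phi(x)\,\psi(\langle y,f(x)\rangle)\,|dx|.$$ Then for any Schwartz–Bruhat function $\phi:K^n\to\mathbb{Q}$ there are real numbers $\alpha<0$ and $c>0$ such that $$|E_\phi(y)|<c\min\{|y|^\alpha,1\}\quad\text{for all }y\in K^r.$$ The same statement also holds in the analytic case: let $f'=(f'_1,\ldots,f'_r):R^n\to K^r$ be a dominant analytic map given by restricted analytic functions $f'_i$, and for a Schwartz–Bruhat function $\phi':R^n\to\mathbb{Q}$ put $E'_{\phi'}(y)=\int_{R^n}\phi'(x)\,\psi(\langle y,f'(x)\rangle)\,|dx|$; then for any such $\phi'$ there are real numbers $\alpha<0$ and $c>0$ such that $|E'_{\phi'}(y)|<c\min\{|y|^\alpha,1\}$ for all $y\in K^r$.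
   Context: $v$ is the $p$-adic valuation on $K$, $q$ the cardinality of the residue field, $|x|=q^{-v(x)}$ for $x\in K$, and $|y|=\max_i|y_i|$ for $y\in K^r$; for $y=0$ and $\alpha<0$ one reads $|y|^\alpha=+\infty$, so the minimum is $1$. On complex numbers $|\cdot|$ is the usual absolute value. $\langle x,y\rangle=x_1y_1+\dots+x_ry_r$. $\psi:K\to\mathbb{C}^\times$ is the standard additive character $\psi(x)=\exp(2\pi i\,\mathrm{Tr}_{K/\mathbb{Q}_p}(x))$ (where $\exp(2\pi i\,\cdot)$ on $\mathbb{Q}_p$ is defined via $\mathbb{Q}_p/\mathbb{Z}_p\cong\mathbb{Z}[1/p]/\mathbb{Z}$). $|dx|$ is the Haar measure on $K^n$ normalized so that $R^n$ has measure $1$. A Schwartz–Bruhat function is a locally constant $\mathbb{Q}$-valued function with compact support. The polynomial map $f$ is dominant if its image is not contained in the zero locus of a nonzero polynomial. A restricted analytic function $R^n\to K$ is a function given by a single power series over $K$ in $n$ variables converging on $R^n$ (coefficients tending to $0$); $f'$ is dominant if $f'(R^n)$ contains a nonempty open subset of $K^r$. *)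

(* Defs.v *)
From HB Require Import structures.
From mathcomp Require Import all_boot all_order all_algebra all_field.
From mathcomp Require Import finmap all_classical all_reals all_analysis.
From mathcomp Require Import complex.
(* The notations of mpoly clash with those of mathcomp-analysis. *)
From mathcomp Require Import -(notations) mpoly.

Set Implicit Arguments.
Unset Strict Implicit.
Unset Printing Implicit Defensive.

Import Order.TTheory GRing.Theory Num.Theory.

Local Open Scope classical_set_scope.
Local Open Scope ring_scope.

Definition padic_valuation_rat (p : nat) (a : rat) : \bar int :=
  if a == 0 then +oo%E
  else ((logn p `|numq a|%N)%:Z - (logn p `|denq a|%N)%:Z)%:E.

Record valuation (F : fieldType) (v : F -> \bar int) : Prop := Valuation {
  valuation0 : v 0 = +oo%E;
  valuation_fin : forall x, x != 0 -> v x \is a fin_num;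
  valuationM : forall x y, v (x * y) = (v x + v y)%E;
  valuationD : forall x y, (Order.min (v x) (v y) <= v (x + y)%R)%E }.

(* (Qp, vp) is the completion of the rationals for the p-adic valuation, which
   determines it up to a unique isomorphism. *)
Record padic_numbers (p : nat) (Qp : fieldType) (vp : Qp -> \bar int) : Prop :=
  PadicNumbers {
  padic_numbers_valuation : valuation vp;
  padic_numbers_rat : forall a : rat, vp (ratr a) = padic_valuation_rat p a;
  padic_numbers_dense : forall (x : Qp) (m : int),
    exists a : rat, (m%:E <= vp (x - ratr a)%R)%E;
  padic_numbers_complete : forall u : nat -> Qp,
    (forall m : int, exists N, forall i j, (N <= i)%N -> (N <= j)%N ->
       (m%:E <= vp (u i - u j)%R)%E) ->
    exists l : Qp, forall m : int, exists N, forall i, (N <= i)%N ->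
       (m%:E <= vp (u i - l)%R)%E }.

(* The valuation of a finite extension K of Qp, normalized to have value group Z; the
   positive integer e is the ramification index. *)
Record padic_valuation (Qp : fieldType) (vp : Qp -> \bar int)
    (K : fieldExtType Qp) (v : K -> \bar int) : Prop := PadicValuation {
  padic_valuation_valuation : valuation v;
  padic_valuation_ext : exists2 e : nat, (0 < e)%N &
    forall a : Qp, v a%:A = ((e%:Z)%:E * vp a)%E;
  padic_valuation_onto : exists x : K, v x = 1%E }.

(* Alias of K carrying the topology defined by v; ['rV[valued v]_n] then
   inherits the product topology. *)
Definition valued (K : fieldType) (v : K -> \bar int) : Type := K.

Section ValuedTopology.
Variables (K : fieldType) (v : K -> \bar int).

HB.instance Definition _ := GRing.Field.on (valued v).
HB.instance Definition _ := isPointed.Build (valued v) (0 : K).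

Definition valued_open : set_system (valued v) :=
  [set A | forall x : valued v, A x ->
     exists m : int, forall y : valued v, (m%:E <= v (y - x)%R)%E -> A y].

Lemma valued_openT : valued_open setT.
Proof. by move=> x _; exists 0. Qed.

Lemma valued_openI : setI_closed valued_open.
Proof.
move=> A B Ao Bo x [Ax Bx].
have [m mA] := Ao x Ax; have [m' mB] := Bo x Bx.
exists (Num.max m m') => y ymm'; split.
  by apply: mA; apply: le_trans ymm'; rewrite lee_fin le_max lexx.
by apply: mB; apply: le_trans ymm'; rewrite lee_fin le_max lexx orbT.
Qed.

Lemma valued_open_bigU (I : Type) (A : I -> set (valued v)) :
  (forall i, valued_open (A i)) -> valued_open (\bigcup_i A i).
Proof.
move=> Ao x [i _ Ax]; have [m mA] := Ao i x Ax.
by exists m => y /mA; exists i.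
Qed.

HB.instance Definition _ := isOpenTopological.Build (valued v)
  valued_openT valued_openI valued_open_bigU.

End ValuedTopology.

Definition val_ring (K : fieldType) (v : K -> \bar int) : set K :=
  [set x | (0 <= v x)%E].

Section Norm.
Variables (R : realType) (K : fieldType) (v : K -> \bar int).

Definition residue_field : set (set K) :=
  [set [set y | val_ring v y /\ (0 < v (y - x)%R)%E] | x in val_ring v].

Definition residue_card : nat := #|` fset_set residue_field|%fset.

Definition vnorm (x : K) : R :=
  if v x is (m%:E)%E then (residue_card%:R : R) ^ (- m) else 0.

Definition vec_norm (r : nat) (y : 'rV[valued v]_r) : R :=
  \big[Num.max/0]_(i < r) vnorm (y 0 i).

(* min {|y|^alpha, 1} for alpha < 0. The case y = 0 is separate because powR
   gives 0 `^ alpha = 0 whereas |0|^alpha is to be read as +oo. *)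
Definition decay (alpha : R) (r : nat) (y : 'rV[valued v]_r) : R :=
  if y == 0 then 1 else Num.min (vec_norm y `^ alpha) 1.

End Norm.

Definition inner (F : fieldType) (r : nat) (x y : 'rV[F]_r) : F :=
  \sum_(i < r) x 0 i * y 0 i.

Definition int_ball (K : fieldType) (v : K -> \bar int) (n : nat) :
  set 'rV[valued v]_n := [set x : 'rV[valued v]_n | forall i, val_ring v (x 0 i)].
Arguments int_ball {K} v n.

Definition field_trace (F : fieldType) (L : fieldExtType F) (x : L) : F :=
  \tr (passmx.mxof (vbasis {:L}) (vbasis {:L}) (amull x)).

Section AdditiveCharacter.
Variables (R : realType) (p : nat) (Qp : fieldType) (vp : Qp -> \bar int).

(* A representative in Z[1/p] of the class of x in Qp / Zp = Z[1/p] / Z. *)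
Definition padic_frac (x : Qp) : rat :=
  xget 0 [set a : rat | (exists (m : int) (k : nat), a = m%:~R / p%:R ^+ k) /\
                        (0 <= vp (x - ratr a)%R)%E].

Definition padic_exp (x : Qp) : R[i] :=
  let t : R := 2 * pi * ratr (padic_frac x) in Complex (cos t) (sin t).

Definition std_char (K : fieldExtType Qp) (x : K) : R[i] :=
  padic_exp (field_trace x).

End AdditiveCharacter.

Definition borel (K : fieldType) (v : K -> \bar int) (n : nat) :=
  g_sigma_algebraType (@open 'rV[valued v]_n).

(* On K^n a translation invariant Borel measure giving R^n mass 1 is finite on
   compact sets, hence Radon: these properties characterize Haar measure. *)
Record haar_measure (R : realType) (K : fieldType) (v : K -> \bar int)
    (n : nat) (mu : {measure set (borel v n) -> \bar R}) : Prop := HaarMeasure {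
  haar_measure_translation :
    forall (x : 'rV[valued v]_n) (A : set 'rV[valued v]_n),
    measurable (A : set (borel v n)) -> mu [set x + y | y in A] = mu A;
  haar_measure_int_ball : mu (int_ball v n) = 1%E }.

Definition Cintegral d (T : measurableType d) (R : realType)
    (mu : {measure set T -> \bar R}) (D : set T) (g : T -> R[i]) : R[i] :=
  Complex (Rintegral mu D (fun x => complex.Re (g x)))
          (Rintegral mu D (fun x => complex.Im (g x))).

(* Locally constant with compact support on the subspace D (here K^n or R^n);
   only the restriction of phi to D matters. *)
Definition schwartz_bruhat (T : topologicalType) (D : set T) (phi : T -> rat) :
    Prop :=
  (forall x, D x -> \forall y \near within D (nbhs x), phi y = phi x) /\
  compact (D `&` closure (D `&` [set x | phi x != 0])).

Definition poly_map (F : fieldType) (n r : nat) (f : 'I_r -> mpoly n F)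
    (x : 'rV[F]_n) : 'rV[F]_r :=
  \row_(i < r) meval (fun j => x 0 j) (f i).

Definition poly_dominant (F : fieldType) (n r : nat) (f : 'I_r -> mpoly n F) :
    Prop :=
  ~ exists2 g : mpoly r F, g != 0 &
      forall x : 'rV[F]_n, meval (fun i => poly_map f x 0 i) g = 0.

Section Analytic.
Variables (K : fieldType) (v : K -> \bar int) (n : nat).

(* The coefficients tend to 0 along the cofinite filter, so the family of
   terms is summable on R^n; its sum is computed by increasing total degree. *)
Definition restricted_analytic (g : 'rV[valued v]_n -> valued v) : Prop :=
  exists a : multinom n -> valued v,
    (forall U : set (valued v), nbhs (0 : valued v) U ->
       finite_set [set m | ~ U (a m)]) /\
    (forall x, int_ball v n x ->
       (fun N : nat => \sum_(m : bmultinom n N)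
          a m * mmap1 (fun j => x 0 j) m : valued v) @ \oo --> g x).

Definition analytic_dominant (r : nat) (f : 'rV[valued v]_n -> 'rV[valued v]_r) :
    Prop :=
  exists2 U : set 'rV[valued v]_r, open U /\ U !=set0 & U `<=` f @` int_ball v n.

End Analytic.

Definition exp_integral (R : realType) (p : nat) (Qp : fieldType)
    (vp : Qp -> \bar int) (K : fieldExtType Qp) (v : K -> \bar int) (n r : nat)
    (mu : {measure set (borel v n) -> \bar R}) (D : set 'rV[valued v]_n)
    (phi : 'rV[valued v]_n -> rat) (F : 'rV[valued v]_n -> 'rV[valued v]_r)
    (y : 'rV[valued v]_r) : R[i] :=
  Cintegral mu D
    (fun x => ratr (phi x) * std_char R p vp (K := K) (inner y (F x))).

(* Main.v *)
Require Import Defs.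
From HB Require Import structures.
From mathcomp Require Import all_boot all_order all_algebra all_field.
From mathcomp Require Import all_classical all_reals all_analysis.
From mathcomp Require Import complex.
From mathcomp Require Import -(notations) mpoly.
From mathcomp Require Import finmap ring lra zify measurable_realfun.

(** The only consequence of dominance that matters is that, for every u <> 0
    in K^r, the function <u, f> is not constant: on K^n because a relation
    <u, f> = c is a nonzero polynomial vanishing on the image, on R^n because a
    nonempty open set is contained in no affine hyperplane. The decay is then
    a p-adic van der Corput estimate, made uniform by compactness.

    Write y = pi^-L u with u of norm 1, pi a uniformizer. Let u0 be of norm 1 and
    x0 a point of the support of phi. Since <u0, f> is not constant there is
    a direction e such that t |-> <u0, f(x0 + t e)> is not constant; this is a
    power series in t, so some coefficient of t^k with k >= 1 is nonzero. The
    coefficients depend continuously on (u, x), so that near (u0, x0) the k-th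
    one keeps its valuation, and on a small enough disc |t| <= |pi|^N it
    dominates all the coefficients of higher degree, even after
    differentiation. In the analytic case all this is done with polynomials h_M that
    approximate f modulo pi^M and are Cauchy for the Gauss norm; what matters is that
    k and the bounds do not depend on M ([line_approx]).

    Because Haar measure is translation invariant, the integral over a ball
    near x0 is bounded by the maximum over x in the ball of the modulus of the mean of
    psi(<y, f(x + t e)>) over any finite set of values of t in a small disc
    ([Rintegral_ball_average]). So it suffices to bound a finite
    exponential sum psi(B(t)), B a polynomial in one variable, with t = t' + pi^l z.
    With l about L/2 the quadratic term in pi^l z is killed by psi, and the sum
    over z is the sum of the additive character psi(B'(t') pi^l z), which vanishes
    unless B'(t') is small ([local_sum_eq0]). Since the coefficient of degree k-1
    of B' dominates those of higher degree, B' is small at no more than k-1 points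
    t' at mutual distance > |pi|^r0, where r0 is about L/(2k)
    ([sublevel_card]). Taking for t' a system of representatives modulo pi^r0, of
    which there are q^r0, the mean is at most (k-1) q^-r0
    ([line_sum_le], [Rintegral_ball_decay]).

    The unit sphere of K^r times the support of phi is compact, so
    finitely many such estimates suffice, which gives one exponent and one
    constant ([exp_integral_decay]). The compactness of R, the finiteness of the
    residue field and the continuity of the trace all come from the equivalence
    of the norm of K with the norm of coordinates over Qp ([coord_bound]). *)

Set Implicit Arguments.
Unset Strict Implicit.
Unset Printing Implicit Defensive.
Import Order.TTheory GRing.Theory Num.Theory.
Local Open Scope classical_set_scope.
Local Open Scope ring_scope.

(** * Valuations and Gauss norms *)

Section ValuationTheory.
Variables (K : fieldType) (v : K -> \bar int).
Hypothesis vP : valuation v.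

(** [vge m x] is |x| <= q^-m as a boolean, which avoids computing with infinite
    valuations; [veq m x] is the corresponding equality. *)
Definition vge (m : int) (x : K) : bool := (m%:E <= v x)%E.

Definition veq (m : int) (x : K) : bool := v x == m%:E.

Lemma vge0 m : vge m 0.
Proof. by rewrite /vge (valuation0 vP) leey. Qed.

Lemma vge_le l m x : (l <= m)%R -> vge m x -> vge l x.
Proof. by move=> lm; apply: le_trans; rewrite lee_fin. Qed.

Lemma vgeD m x y : vge m x -> vge m y -> vge m (x + y).
Proof.
move=> mx my; apply: le_trans (valuationD vP x y).
by rewrite le_min; apply/andP.
Qed.

Lemma v_fin x : x != 0 -> exists m, v x = m%:E.
Proof. by move=> /(valuation_fin vP); case: (v x) => // m _; exists m. Qed.

Lemma veq_neq0 m x : veq m x -> x != 0.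
Proof. by apply: contraTneq => ->; rewrite /veq (valuation0 vP). Qed.

Lemma veq_exists x : x != 0 -> exists m, veq m x.
Proof. by move=> /v_fin[m vm]; exists m; apply/eqP. Qed.

Lemma vge_all0 x : (forall m : nat, vge m%:Z x) -> x = 0.
Proof.
move=> h; apply/eqP/negPn/negP => /v_fin[m vm].
by have := h `|m|.+1%N; rewrite /vge vm lee_fin; lia.
Qed.

Lemma veqM m l x y : veq m x -> veq l y -> veq (m + l) (x * y).
Proof. by move=> /eqP mx /eqP ly; rewrite /veq (valuationM vP) mx ly. Qed.

Lemma vgeM m l x y : vge m x -> vge l y -> vge (m + l) (x * y).
Proof.
rewrite /vge (valuationM vP).
case: (eqVneq x 0) => [->|/v_fin[a ->]].
  case: (eqVneq y 0) => [->|/v_fin[b ->]]; by rewrite (valuation0 vP) /= !leey.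
case: (eqVneq y 0) => [->|/v_fin[b ->]]; first by rewrite (valuation0 vP) /= !leey.
by rewrite -EFinD !lee_fin => *; apply: lerD.
Qed.

Lemma veq1 : veq 0 1.
Proof.
have [m vm] := v_fin (oner_neq0 K).
have := valuationM vP 1 1; rewrite mulr1 vm -EFinD => -[].
by move=> h; rewrite /veq vm; apply/eqP; congr (_%:E); lia.
Qed.

Lemma veq_vge m x : veq m x -> vge m x.
Proof. by rewrite /vge => /eqP ->. Qed.

Lemma veqE m x : veq m x = vge m x && ~~ vge (m + 1) x.
Proof.
rewrite /veq /vge; case: (eqVneq x 0) => [->|/v_fin[a ->]].
  by rewrite (valuation0 vP) !leey.
by rewrite !lee_fin eqe; lia.
Qed.

Lemma veq_inj m l x : veq m x -> veq l x -> m = l.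
Proof. by rewrite /veq => /eqP -> /eqP[]. Qed.

Lemma vge_veq l m x : veq m x -> vge l x = (l <= m)%R.
Proof. by rewrite /vge => /eqP ->; rewrite lee_fin. Qed.

Lemma veqN1 : veq 0 (-1 : K).
Proof.
have /veq_exists[m vm] : (-1 : K) != 0 by rewrite oppr_eq0 oner_neq0.
have := veqM vm vm; rewrite mulrNN mulr1 => /veq_inj/(_ veq1) h.
by have -> : 0 = m by lia.
Qed.

Lemma vgeN m x : vge m (- x) = vge m x.
Proof.
suff h y : vge m y -> vge m (- y).
  by apply/idP/idP => /h; rewrite ?opprK.
by move=> /(vgeM (veq_vge veqN1)); rewrite mulN1r add0r.
Qed.

Lemma vgeB m x y : vge m x -> vge m y -> vge m (x - y).
Proof. by move=> mx my; rewrite vgeD ?vgeN. Qed.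

Lemma vge_subC m x y : vge m (x - y) = vge m (y - x).
Proof. by rewrite -vgeN opprB. Qed.

Lemma vge_trans m x y z : vge m (x - y) -> vge m (y - z) -> vge m (x - z).
Proof. by move=> h /(vgeD h); rewrite addrA subrK. Qed.

Lemma vge_addl m x y : vge m x -> vge m (x + y) = vge m y.
Proof.
move=> mx; apply/idP/idP => [|my]; last exact: vgeD.
by move=> /vgeB/(_ mx); rewrite addrC addKr.
Qed.

Lemma veqD m x y : veq m x -> vge (m + 1) y -> veq m (x + y).
Proof.
rewrite !veqE => /andP[h1 h2] hy; rewrite vgeD ?h1 //=; last first.
  by apply: vge_le hy; lia.
by rewrite [x + y]addrC vge_addl.
Qed.

Lemma vge_sum (I : Type) (s : seq I) (P : pred I) (F : I -> K) m :
  (forall i, P i -> vge m (F i)) -> vge m (\sum_(i <- s | P i) F i).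
Proof. by move=> h; elim/big_ind: _ => //; [exact: vge0|exact: vgeD]. Qed.

Lemma vge_nat (n : nat) : vge 0 (n%:R : K).
Proof.
elim: n => [|n IH]; first exact: vge0.
by rewrite mulrS vgeD // veq_vge // veq1.
Qed.

Lemma vge0M m x y : vge 0 x -> vge m y -> vge m (x * y).
Proof. by move=> hx hy; have := vgeM hx hy; rewrite add0r. Qed.

Lemma vgeM0 m x y : vge m x -> vge 0 y -> vge m (x * y).
Proof. by move=> hx hy; have := vgeM hx hy; rewrite addr0. Qed.

Lemma vge0X x n : vge 0 x -> vge 0 (x ^+ n).
Proof.
move=> hx; elim: n => [|n IH]; first by rewrite expr0 veq_vge ?veq1.
by rewrite exprS vge0M.
Qed.

Lemma veqV m x : veq m x -> veq (- m) x^-1.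
Proof.
move=> mx; have x0 := veq_neq0 mx.
have /veq_exists[l lx] : x^-1 != 0 by rewrite invr_eq0.
have := veqM mx lx; rewrite mulfV // => /veq_inj/(_ veq1) h.
by have -> : - m = l by lia.
Qed.

Lemma veqX m x n : veq m x -> veq (m * n%:Z) (x ^+ n).
Proof.
move=> mx; elim: n => [|n IH]; first by rewrite mulr0 expr0 veq1.
by rewrite exprS; have := veqM mx IH; congr veq; lia.
Qed.

(** Division by an element of known valuation: this is the form in which
    scaling by powers of a uniformizer is used throughout. *)
Lemma vge_mulr_veq l m x y : veq m x -> vge l (x * y) = vge (l - m) y.
Proof.
move=> mx; apply/idP/idP => [|/(vgeM (veq_vge mx))]; last first.
  by apply: vge_le; lia.
move=> /(vgeM (veq_vge (veqV mx))); rewrite mulKf ?(veq_neq0 mx) //.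
by apply: vge_le; lia.
Qed.

(** The Gauss norm of P is at most q^-m. *)
Definition gauss_ge (m : int) (P : {poly K}) := forall j : nat, vge m P`_j.

Lemma gauss_ge0 m : gauss_ge m 0.
Proof. by move=> j; rewrite coef0 vge0. Qed.

Lemma gauss_geD m P Q : gauss_ge m P -> gauss_ge m Q -> gauss_ge m (P + Q).
Proof. by move=> hP hQ j; rewrite coefD vgeD. Qed.

Lemma gauss_geM m l P Q :
  gauss_ge m P -> gauss_ge l Q -> gauss_ge (m + l) (P * Q).
Proof.
by move=> hP hQ j; rewrite coefM vge_sum // => i _; apply: vgeM.
Qed.

Lemma gauss_geC m c : vge m c -> gauss_ge m c%:P.
Proof. by move=> h j; rewrite coefC; case: ifP => _; rewrite ?vge0. Qed.

Lemma gauss_geZ m l c P : vge m c -> gauss_ge l P -> gauss_ge (m + l) (c *: P).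
Proof. by move=> h hP j; rewrite coefZ vgeM. Qed.

Lemma gauss_ge_sum (I : Type) (s : seq I) (F : I -> {poly K}) m :
  (forall i, gauss_ge m (F i)) -> gauss_ge m (\sum_(i <- s) F i).
Proof.
by move=> h; elim/big_ind: _ => //; [exact: gauss_ge0|exact: gauss_geD].
Qed.

Lemma gauss_geX P n : gauss_ge 0 P -> gauss_ge 0 (P ^+ n).
Proof.
move=> h; elim: n => [|n IH].
  by rewrite expr0; apply: gauss_geC; rewrite veq_vge ?veq1.
by rewrite exprS; have := gauss_geM h IH; rewrite addr0.
Qed.

Lemma vge_horner m P t : gauss_ge m P -> vge 0 t -> vge m P.[t].
Proof.
move=> hP ht; rewrite horner_coef vge_sum // => i _.
by rewrite vgeM0 // vge0X.
Qed.

End ValuationTheory.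

Lemma vge_ex (K : fieldType) (v : K -> \bar int) (x : K) :
  valuation v -> exists m, vge v m x.
Proof.
move=> vP; have [->|/(veq_exists vP)[m /veq_vge]] := eqVneq x 0; last by exists m.
by exists 0; rewrite vge0.
Qed.

Lemma vge_ex_fin (K : fieldType) (v : K -> \bar int) (I : finType) (F : I -> K) :
  valuation v -> exists m, forall i, vge v m (F i).
Proof.
move=> vP; have /choice[M hM] : forall i, exists m, vge v m (F i) by move=> i; exact: vge_ex.
(* minus the sum of the absolute values is below every M i *)
exists (- (\sum_i `|M i|%N)%:Z) => i; apply: vge_le (hM i).
by rewrite (bigD1 i) //= PoszD; lia.
Qed.

(** * Sublevel sets of polynomials in one variable *)

Section Sublevel.
Variables (K : fieldType) (v : K -> \bar int).
Hypothesis vP : valuation v.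
Local Notation vge := (vge v).
Local Notation veq := (veq v).
Local Notation gauss_ge := (gauss_ge v).

(** What restricting a power series to a small disc achieves: high degrees become
    negligible, while low degrees stay uncontrolled. *)
Definition dominant_coef (w : int) (m : nat) (H : {poly K}) : Prop :=
  veq w H`_m /\ forall j, (m < j)%N -> vge (w + 1) H`_j.

(** The coefficients of the quotient by X - t are h_{j+1} + t h_{j+2} + t^2
    h_{j+3} + ..., so the dominant coefficient moves down by one degree; the
    recursion for them is run from the top degree. *)
Lemma dominant_coef_quotient w m (H H1 : {poly K}) t c :
  vge 0 t -> H = H1 * ('X - t%:P) + c%:P ->
  dominant_coef w m.+1 H -> dominant_coef w m H1.
Proof.
move=> t0 HE [Hm Hj].
have qE j : H1`_j = H`_j.+1 + t * H1`_j.+1.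
  by rewrite HE coefD coefC /= addr0 mulrBr coefB coefMX coefMC /= mulrC subrK.
have hi d j : (size H1 <= j + d)%N -> (m < j)%N -> vge (w + 1) H1`_j.
  elim: d j => [|d IH] j; first by rewrite addn0 => /(nth_default 0) ->; rewrite vge0.
  rewrite addnS -addSn => sj mj; rewrite qE vgeD //.
    by apply: Hj; lia.
  by apply: vge0M => //; apply: IH => //; lia.
have {}hi j : (m < j)%N -> vge (w + 1) H1`_j.
  by apply: (hi (size H1)); rewrite leq_addl.
split=> //; rewrite qE; apply: veqD => //.
by apply: vge0M => //; exact: hi.
Qed.

(** A divided difference argument. If H is small at t1 and at t, with t - t1
    not too small, then H1 = (H - H(t1)) / (X - t1) is still rather small at t; and
    H1 has a dominant coefficient in degree m - 1. After m steps one is left with a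
    polynomial of constant norm, which cannot be small. *)
Lemma sublevel_card m (H : {poly K}) (w h : int) (r0 : nat) (ts : seq K) :
  dominant_coef w m H -> w + m%:Z * r0%:Z < h ->
  (forall t, t \in ts -> vge 0 t) ->
  pairwise (fun t t' => ~~ vge r0 (t - t')) ts ->
  (forall t, t \in ts -> vge h H.[t]) ->
  (size ts <= m)%N.
Proof.
elim: m H h ts => [|m IH] H h [|t1 ts] // Hdom wh ts0 tsep tsub.
  have [H0 Hj] := Hdom.
  have := tsub t1 (mem_head _ _); rewrite (@vge_veq _ _ h w); last first.
    have -> : H.[t1] = H`_0 + \sum_(1 <= j < (size H).+1) H`_j * t1 ^+ j.
      rewrite (horner_coef_wide (n := (size H).+1)) //.
      by rewrite -(big_mkord xpredT (fun j => H`_j * t1 ^+ j)) big_nat_recl // expr0 mulr1 big_add1.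
    apply: (veqD vP) => //; rewrite big_nat_cond; apply: (vge_sum vP) => j.
    rewrite andbT => /andP[j1 _].
    by apply: vgeM0; [|exact: Hj|apply: vge0X => //; apply: ts0; rewrite mem_head].
  by move=> hw; lia.
have t10 : vge 0 t1 by apply: ts0; rewrite mem_head.
have [H1 HE] : {H1 | H = H1 * ('X - t1%:P) + H.[t1]%:P}.
  by exists (H %/ ('X - t1%:P)); rewrite {1}(divp_eq H ('X - t1%:P)) modp_XsubC.
move: tsep; rewrite pairwise_cons => /andP[/allP sep1 tsep].
rewrite /= ltnS; apply: (IH H1 (h - r0%:Z)) => //.
- exact: dominant_coef_quotient HE Hdom.
- by lia.
- by move=> t tt; apply: ts0; rewrite inE tt orbT.
move=> t tt; have := sep1 t tt; rewrite vge_subC //.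
have [->|] := eqVneq (t - t1) 0; first by rewrite vge0.
move=> /(veq_exists vP)[a va]; rewrite (vge_veq _ va) -ltNge => ar.
have : vge h ((t - t1) * H1.[t]).
  have -> : (t - t1) * H1.[t] = H.[t] - H.[t1].
    by rewrite {1}HE !hornerE mulrC addrK.
  by apply: vgeB => //; apply: tsub; rewrite ?mem_head // inE tt orbT.
by rewrite (vge_mulr_veq vP _ _ va); apply: vge_le; lia.
Qed.

(** Taylor expansion of order one without denominators: the second divided
    difference of B has the same bound on its coefficients as B. *)
Lemma vge_taylor1 c (B : {poly K}) (l : nat) t z :
  gauss_ge c B -> vge 0 t -> vge l z ->
  vge (c + l%:Z + l%:Z) (B.[t + z] - B.[t] - B^`().[t] * z).
Proof.
move=> gB t0 zl.
have z0 : vge 0 z by apply: vge_le zl; lia.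
have mono j : vge (l%:Z + l%:Z) ((t + z) ^+ j - t ^+ j - (t ^+ j.-1 *+ j) * z).
  elim: j => [|j IH]; first by rewrite !expr0 mulr0n mul0r subrr subr0 vge0.
  have -> : (t + z) ^+ j.+1 - t ^+ j.+1 - t ^+ j.+1.-1 *+ j.+1 * z =
    (t + z) * ((t + z) ^+ j - t ^+ j - (t ^+ j.-1 *+ j) * z) + (t ^+ j.-1 *+ j) * z * z.
    case: j {IH} => [|j]; rewrite ?mulr0n /=; first by ring.
    by rewrite !exprS !mulrS; ring.
  apply: vgeD => //; first by apply: vge0M => //; apply: vgeD.
  rewrite -mulrA; apply: vge0M; rewrite ?vgeM //.
  by rewrite -mulr_natr vge0M ?vge_nat ?vge0X.
have -> : B.[t + z] - B.[t] - B^`().[t] * z =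
   \sum_(j < size B) B`_j * ((t + z) ^+ j - t ^+ j - (t ^+ j.-1 *+ j) * z).
  rewrite !horner_coef.
  have -> : \sum_(i < size B^`()) B^`()`_i * t ^+ i = \sum_(j < size B) B`_j * (t ^+ j.-1 *+ j).
    rewrite -horner_coef (horner_coef_wide (n := size B)); last first.
      exact: leq_trans (size_poly _ _) (leq_pred _).
    case: (size B) (@nth_default _ 0 B) => [|s] sB; first by rewrite !big_ord0.
    rewrite big_ord_recr [RHS]big_ord_recl /= mulr0n mulr0 add0r.
    rewrite coef_deriv sB // mul0rn mul0r addr0; apply: eq_bigr => i _.
    by rewrite coef_deriv mulrnAl mulrnAr.
  rewrite mulr_suml -!sumrB; apply: eq_bigr => i _; ring.
apply: vge_sum => // j _; rewrite -addrA; exact: vgeM.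
Qed.

End Sublevel.

(** * Digit expansions and exponential sums over discs *)

Record residue_system (K : fieldType) (v : K -> \bar int) (A : seq K) : Prop :=
  ResidueSystem {
  residue_system_int : {in A, forall a, vge v 0 a};
  residue_system_uniq : uniq A;
  residue_system_inj : {in A &, forall a b, vge v 1 (a - b) -> a = b};
  residue_system_onto :
    forall x, vge v 0 x -> exists2 a, a \in A & vge v 1 (x - a) }.

Section Digits.
Variables (K : fieldType) (v : K -> \bar int).
Hypothesis vP : valuation v.
Local Notation vge := (vge v).
Local Notation veq := (veq v).
Variables (varpi : K) (A : seq K).
Hypothesis varpi1 : veq 1 varpi.
Hypothesis AP : residue_system v A.
Let A_int := residue_system_int AP.
Let A_uniq := residue_system_uniq AP.
Let A_inj := residue_system_inj AP.
Let A_onto := residue_system_onto AP.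

(** The polynomials of degree less than r in varpi with coefficients in A: they
    represent the valuation ring modulo varpi^r. *)
Fixpoint digits (r : nat) : seq K :=
  if r is r'.+1 then [seq a + varpi * t | a <- A, t <- digits r'] else [:: 0].

Lemma size_digits r : size (digits r) = (size A ^ r)%N.
Proof. by elim: r => //= r IH; rewrite size_allpairs IH expnS. Qed.

Lemma digits_int r : {in digits r, forall t, vge 0 t}.
Proof.
elim: r => [|r IH] t /=; first by rewrite inE => /eqP ->; rewrite vge0.
move=> /allpairsP[[a s] /= [aA sr ->]]; apply: vgeD => //; first exact: A_int.
by apply: vgeM0 => //; [apply: vge_le (veq_vge varpi1)|exact: IH].
Qed.

Lemma digits_onto r x : vge 0 x -> exists2 t, t \in digits r & vge r (x - t).
Proof.
elim: r x => [|r IH] x x0 /=.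
  by exists 0; rewrite ?subr0 ?inE.
have [a aA xa] := A_onto x0.
have pi0 := veq_neq0 vP varpi1.
have [|t tr xt] := IH ((x - a) / varpi).
  rewrite -(_ : 1 - 1 = 0) // -(vge_mulr_veq vP _ _ varpi1).
  by rewrite mulrC divfK.
exists (a + varpi * t); first by apply/allpairsP; exists (a, t).
have -> : x - (a + varpi * t) = varpi * ((x - a) / varpi - t).
  by rewrite mulrBr [varpi * (_ / _)]mulrC divfK // opprD addrA.
by rewrite (vge_mulr_veq vP _ _ varpi1); apply: vge_le xt; lia.
Qed.

Lemma digits_inj r : {in digits r &, forall t t', vge r (t - t') -> t = t'}.
Proof.
elim: r => [|r IH] t t' /=; first by rewrite !inE => /eqP -> /eqP ->.
move=> /allpairsP[[a s] /= [aA sr ->]] /allpairsP[[b u] /= [bA ur ->]] h.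
have abE : a - b = (a + varpi * s - (b + varpi * u)) - varpi * (s - u) by ring.
have ab : a = b.
  apply: A_inj => //; rewrite abE; apply: vgeB => //; first by apply: vge_le h; lia.
  by apply: vgeM0; [|exact: veq_vge|apply: vgeB; rewrite ?(digits_int (r := r))].
congr (_ + _ * _) => //; apply: IH => //.
move: h; rewrite ab opprD addrACA subrr add0r -mulrBr (vge_mulr_veq vP _ _ varpi1).
by apply: vge_le; lia.
Qed.

Lemma digits_uniq r : uniq (digits r).
Proof.
elim: r => //= r IH; apply: allpairs_uniq => //.
move=> [a s] [b u] /allpairsP[[a' s'] /= [aA sr [-> ->]]].
move=> /allpairsP[[b' u'] /= [bA ur [-> ->]]] /= h.
have ab : a' = b'.
  apply: A_inj => //.
  have -> : a' - b' = varpi * (u' - s') by rewrite -[a'](addrK (varpi * s')) h; ring.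
  by apply: vgeM0; [|exact: veq_vge|apply: vgeB; rewrite ?(digits_int (r := r))].
by move: h; rewrite ab => /addrI/(mulfI (veq_neq0 vP varpi1)) ->.
Qed.

(** Translation by z1 permutes the classes modulo varpi^j, hence multiplies the sum
    by E (c z1) without changing it. *)
Lemma sum_digits_char (C : idomainType) (j : nat) (E : K -> C) c z1 :
  (forall x y, E (x + y) = E x * E y) ->
  (forall z, vge j z -> E (c * z) = 1) ->
  vge 0 z1 -> E (c * z1) != 1 ->
  \sum_(z <- digits j) E (c * z) = 0.
Proof.
move=> ED Ej z10 Ez1.
(* the digit expansion congruent to x modulo varpi^j *)
pose rep x := nth 0 (digits j) (find (fun t => vge j (x - t)) (digits j)).
have repP x : vge 0 x -> rep x \in digits j /\ vge j (x - rep x).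
  move=> /(digits_onto j)[t tj xt].
  have h : has (fun t => vge j (x - t)) (digits j) by apply/hasP; exists t.
  by rewrite mem_nth -?has_find //; split=> //; exact: (nth_find 0 h).
have zint := @digits_int j.
have rint z : z \in digits j -> vge 0 (z + z1) by move=> /zint hz; apply: vgeD.
have rinj : {in digits j &, injective (fun z => rep (z + z1))}.
  move=> z z' hz hz' /= e; apply: (@digits_inj j) => //.
  have [_ h1] := repP _ (rint _ hz); have [_ h2] := repP _ (rint _ hz').
  have -> : z - z' = (z + z1 - rep (z + z1)) - (z' + z1 - rep (z' + z1)).
    by rewrite e; ring.
  exact: vgeB.
have perm : perm_eq [seq rep (z + z1) | z <- digits j] (digits j).
  have ru : uniq [seq rep (z + z1) | z <- digits j].
    by rewrite map_inj_in_uniq // digits_uniq.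
  have sub : {subset [seq rep (z + z1) | z <- digits j] <= digits j}.
    by move=> _ /mapP[z hz ->]; have [] := repP _ (rint _ hz).
  have [|_ e] := uniq_min_size ru sub; first by rewrite size_map.
  by apply: uniq_perm => //; exact: digits_uniq.
have shift : \sum_(z <- digits j) E (c * z) = E (c * z1) * \sum_(z <- digits j) E (c * z).
  rewrite -[LHS](perm_big _ perm) /= big_map mulr_sumr.
  rewrite big_seq [RHS]big_seq; apply: eq_bigr => z hz.
  have [_ h] := repP _ (rint _ hz).
  rewrite -ED -mulrDr [z1 + z]addrC.
  have -> : c * (z + z1) = c * (z + z1 - rep (z + z1)) + c * rep (z + z1) by ring.
  by rewrite [RHS]ED (Ej _ h) mul1r.
have /eqP : (E (c * z1) - 1) * \sum_(z <- digits j) E (c * z) = 0.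
  by rewrite mulrBl mul1r -shift subrr.
by rewrite mulf_eq0 subr_eq0 (negbTE Ez1) /= => /eqP.
Qed.

Section LineSum.
Variables (R : realType) (E : K -> R[i]).
Hypothesis ED : forall x y, E (x + y) = E x * E y.
Variables (d d' : int) (z0 : K).
Hypothesis Ed : forall x, vge d x -> E x = 1.
Hypothesis z0d' : veq d' z0.
Hypothesis Ez0 : E z0 != 1.
Variable (B : {poly K}) (c : int) (l j : nat).
Hypothesis Bc : gauss_ge v c B.
Hypothesis cl : (d <= c + l%:Z + l%:Z)%R.
Hypothesis cj : (d <= c + l%:Z + j%:Z)%R.

(** The conditions on l make the second order Taylor term invisible to E, so that
    the sum over the disc t + varpi^l R is the sum of a character of R, namely
    z |-> E (B'(t) varpi^l z). It is nontrivial as soon as |B'(t) varpi^l| >= |z0|. *)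
Lemma local_sum_eq0 t : vge 0 t -> ~~ vge (d' + 1 - l%:Z) B^`().[t] ->
  \sum_(z <- digits j) E B.[t + varpi ^+ l * z] = 0.
Proof.
move=> t0 good.
have gl : veq l (varpi ^+ l) by have := veqX vP l varpi1; rewrite mul1r.
have B'c : gauss_ge v c B^`().
  by move=> i; rewrite coef_deriv -mulr_natr vgeM0 ?vge_nat.
have eta_c : vge c B^`().[t] by apply: vge_horner.
have [a va] : exists a, veq a B^`().[t].
  by apply: (veq_exists vP); apply: contraNneq good => ->; rewrite vge0.
have al : (a + l%:Z <= d')%R by move: good; rewrite (vge_veq _ va); lia.
have ca : (c <= a)%R by rewrite -(vge_veq _ va).
have vc : veq (a + l%:Z) (B^`().[t] * varpi ^+ l) by apply: veqM.
rewrite big_seq.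
rewrite (eq_bigr (fun z => E B.[t] * E ((B^`().[t] * varpi ^+ l) * z))); last first.
  move=> z /digits_int z_int.
  have h : vge (c + l%:Z + l%:Z) (B.[t + varpi ^+ l * z] - B.[t] - B^`().[t] * (varpi ^+ l * z)).
    by apply: vge_taylor1 => //; apply: vgeM0 => //; exact: veq_vge.
  set w := (X in vge _ X) in h.
  have -> : B.[t + varpi ^+ l * z] = w + B.[t] + B^`().[t] * varpi ^+ l * z.
    by rewrite /w; ring.
  by rewrite 2!ED (Ed (vge_le cl h)) mul1r.
rewrite -big_seq -mulr_sumr.
(* z1 is chosen so that the argument of E becomes z0 *)
rewrite (sum_digits_char (z1 := z0 / (B^`().[t] * varpi ^+ l))) ?mulr0 //.
- move=> z zj; apply: Ed; apply: vge_le (vgeM vP (veq_vge vc) zj); lia.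
- by rewrite (vge_veq _ (veqM vP z0d' (veqV vP vc))); lia.
- by rewrite mulrC divfK // (veq_neq0 vP vc).
Qed.

(** The van der Corput estimate: the discs t + varpi^l R on which the derivative is
    large contribute nothing, and by [sublevel_card] at most m of the others have
    their center among the representatives modulo varpi^r0. *)
Lemma line_sum_le (m r0 : nat) (w : int) (xi : R[i] -> R) :
  {morph xi : a b / a + b} -> (forall x, `|xi (E x)| <= 1) ->
  dominant_coef v w m B^`() -> w + m%:Z * r0%:Z < d' + 1 - l%:Z ->
  `|\sum_(t <- digits r0) \sum_(z <- digits j) xi (E B.[t + varpi ^+ l * z])|
    <= m%:R * (size A ^ j)%:R.
Proof.
move=> xiD xi1 dom wm.
have xi0 : xi 0 = 0.
  by have /eqP := xiD 0 0; rewrite addr0 -subr_eq0 opprD addNKr oppr_eq0 => /eqP.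
pose bad t := vge (d' + 1 - l%:Z) B^`().[t].
have sumE t : \sum_(z <- digits j) xi (E B.[t + varpi ^+ l * z]) =
   xi (\sum_(z <- digits j) E B.[t + varpi ^+ l * z]) by rewrite (big_morph xi xiD xi0).
rewrite (bigID bad) /= [X in _ + X]big_seq_cond [X in _ + X]big1 ?addr0; last first.
  by move=> t /andP[/digits_int t0 good]; rewrite sumE local_sum_eq0.
apply: le_trans (ler_norm_sum _ _ _) _.
apply: (@le_trans _ _ (\sum_(t <- digits r0 | bad t) (size A ^ j)%:R)).
  apply: ler_sum => t _; apply: le_trans (ler_norm_sum _ _ _) _.
  apply: le_trans (ler_sum _ (fun i _ => xi1 _)) _.
  by rewrite big_const_seq count_predT size_digits iter_addr_0.
(* what is left is the number of bad centers times the trivial bound *)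
rewrite -big_filter big_const_seq count_predT iter_addr_0 -[X in X <= _]mulr_natl.
rewrite ler_wpM2r // ler_nat.
apply: (sublevel_card vP dom wm) => [t||t].
- by rewrite mem_filter => /andP[_ /digits_int].
- have : pairwise (fun t t' => ~~ vge r0 (t - t')) (digits r0).
    have := digits_uniq r0; rewrite uniq_pairwise.
    apply: (sub_in_pairwise (P := mem (digits r0))); last exact/allP.
    by move=> t t' ht ht' /=; apply: contra => h; apply/eqP; apply: (@digits_inj r0).
  by apply: subseq_pairwise; exact: filter_subseq.
- by rewrite mem_filter => /andP[].
Qed.

End LineSum.
End Digits.

(** * The norm of a finite extension of the p-adic numbers *)

Section NormEquivalence.
Variables (p : nat) (Qp : fieldType) (vp : Qp -> \bar int).
Hypothesis QpP : padic_numbers p vp.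
Variables (K : fieldExtType Qp) (v : K -> \bar int).
Hypothesis vP : padic_valuation vp v.

Let vpV : valuation vp := padic_numbers_valuation QpP.
Let vV : valuation v := padic_valuation_valuation vP.

Lemma vge_alg : exists2 e : nat, (0 < e)%N &
  forall (m : int) (a : Qp), vge v (e%:Z * m) a%:A = vge vp m a.
Proof.
have [e e0 ve] := padic_valuation_ext vP; exists e => // m a.
rewrite /vge ve; have [->|/(v_fin vpV)[k ->]] := eqVneq a 0.
  by rewrite (valuation0 vpV) gt0_muley ?leey //.
by rewrite -EFinM !lee_fin ler_pM2l //; lia.
Qed.

Lemma scale_alg (a : Qp) (x : K) : a *: x = a%:A * x.
Proof. by rewrite mulr_algl. Qed.

(** Equivalence of norms, by induction on the number of vectors. The span W of
    the first m vectors is complete by induction, because its coordinates are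
    controlled, hence closed; so b m has a positive distance |pi|^D to W. This bounds
    the last coordinate of a linear combination, and then the others. *)
Lemma coord_bound (b : nat -> K) (m : nat) :
  (forall a : nat -> Qp, \sum_(i < m) a i *: b i = 0 -> forall i, (i < m)%N -> a i = 0) ->
  exists C : int, forall (a : nat -> Qp) M, vge v M (\sum_(i < m) a i *: b i) ->
    forall i, (i < m)%N -> vge v (M - C) (a i)%:A.
Proof.
have [e e0 vE] := vge_alg.
elim: m => [|m IH] indep; first by exists 0.
have [|C hC] := IH.
  move=> a a0 i im; pose a' i := if (i < m)%N then a i else 0.
  have := indep a' _ i (ltnW im); rewrite /a' im; apply.
  rewrite big_ord_recr /= ltnn scale0r addr0 -[RHS]a0.
  by apply: eq_bigr => j _; rewrite ltn_ord.
(* otherwise b m is a limit of elements of W, hence belongs to W *)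
have [D hD] : exists D, forall a : nat -> Qp, ~~ vge v D (b m + \sum_(i < m) a i *: b i).
  apply: contrapT => hN.
  have /choice[a ha] : forall D : nat, exists a : nat -> Qp,
      vge v D (b m + \sum_(i < m) a i *: b i).
    move=> D; apply: contrapT => h; apply: hN; exists D%:Z => a.
    by apply/negP => ?; apply: h; exists a.
  have cauchy (N k k' : nat) i : (i < m)%N -> (N <= k)%N -> (N <= k')%N ->
      vge v (N%:Z - C) (a k i - a k' i)%:A.
    move=> im Nk Nk'.
    apply: (hC (fun i => a k i - a k' i)) => //.
    have -> : \sum_(i < m) (a k i - a k' i) *: b i =
       (b m + \sum_(i < m) a k i *: b i) - (b m + \sum_(i < m) a k' i *: b i).
      rewrite opprD addrACA subrr add0r -sumrB; apply: eq_bigr => j _.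
      by rewrite scalerBl.
    by apply: vgeB => //; apply: vge_le (ha _); lia.
  have /choice[l hl] : forall i, exists l : Qp, (i < m)%N ->
      forall M : int, exists N, forall k, (N <= k)%N -> vge vp M (a k i - l).
    move=> i; case: (ltnP i m) => im; last by exists 0.
    have [|l hl] := padic_numbers_complete QpP (u := fun k => a k i); last by exists l.
    move=> M; exists `|(e%:Z * M + C)%R|%N => k k' hk hk'.
    have := cauchy _ _ _ _ im hk hk'; rewrite -[(_ <= _)%E]/(vge vp _ _) -vE.
    by apply: vge_le; lia.
  have lim0 : b m + \sum_(i < m) l i *: b i = 0.
    apply: (vge_all0 vV) => M.
    have /choice[N hN'] : forall i, exists N, (i < m)%N -> forall k, (N <= k)%N ->
        vge v M ((l i - a k i) *: b i).
      move=> i; have [im|_] := ltnP i m; last by exists 0%N.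
      have [B hB] := vge_ex (b i) vV.
      have [N hN''] := hl i im `|(M%:Z - B)%R|%N%:Z; exists N => _ k Nk.
      rewrite scale_alg; have := hN'' k Nk; rewrite vge_subC // -vE.
      move=> /(vgeM vV)/(_ hB); apply: vge_le.
      by have := leq_pmull `|(M%:Z - B)%R|%N e0; rewrite -lez_nat PoszM; lia.
    pose k := maxn M (\max_(i < m) N i).
    have -> : b m + \sum_(i < m) l i *: b i =
       (b m + \sum_(i < m) a k i *: b i) + \sum_(i < m) (l i - a k i) *: b i.
      rewrite -addrA -big_split; congr (_ + _); apply: eq_bigr => i _ /=.
      by rewrite -scalerDl addrC subrK.
    apply: vgeD => //; first by apply: vge_le (ha k); rewrite lez_nat leq_maxl.
    apply: vge_sum => // i _; apply: hN'; rewrite ?ltn_ord //.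
    by rewrite leq_max (leq_bigmax (F := fun i : 'I_m => N i)) orbT.
  pose a' i := if (i < m)%N then l i else 1.
  have := indep a' _ m (ltnSn m); rewrite /a' ltnn => h.
  have /eqP : (1 : Qp) = 0.
    apply: h; rewrite big_ord_recr /= ltnn scale1r addrC -[RHS]lim0; congr (_ + _).
    by apply: eq_bigr => i _; rewrite ltn_ord.
  by rewrite oner_eq0.
have [B hB] := vge_ex (b m) vV.
exists (`|C| + `|D| + `|B|) => a M; rewrite big_ord_recr /= => hM.
(* divide the linear combination by its last coordinate and apply hD *)
have am : vge v (M - `|D|) (a m)%:A.
  have [->|am0] := eqVneq (a m) 0; first by rewrite scale0r vge0.
  have [al val] : exists al, veq v al (a m)%:A.
    by apply: (veq_exists vV); rewrite scaler_eq0 oner_eq0 orbF.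
  have := hD (fun i => a i / a m).
  rewrite -[vge _ _ _]/(vge v D _); have {1}-> : D = al + D - al by lia.
  rewrite -(vge_mulr_veq vV _ _ val) mulrDr.
  rewrite mulr_sumr (eq_bigr (fun i : 'I_m => a i *: b i)); last first.
    by move=> i _; rewrite -scale_alg scalerA mulrC divfK.
  rewrite -scale_alg [X in vge _ _ X]addrC => h; rewrite (vge_veq _ val) lerBlDr leNgt.
  by apply: contra h => h; apply: vge_le hM; lia.
have rest : vge v (M - `|D| - `|B|) (\sum_(i < m) a i *: b i).
  rewrite -[X in vge v _ X](addrK (a m *: b m)); apply: vgeB => //.
    by apply: vge_le hM; lia.
  by rewrite scale_alg; apply: vge_le (vgeM vV am hB); lia.
move=> i; rewrite ltnS leq_eqVlt => /orP[/eqP ->|im].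
  by apply: vge_le am; lia.
by apply: vge_le (hC _ _ rest i im); lia.
Qed.

End NormEquivalence.

(** * The additive character of the p-adic numbers *)

Section PadicExponential.
Variables (p : nat) (Qp : fieldType) (vp : Qp -> \bar int).
Hypothesis p_prime : prime p.
Hypothesis QpP : padic_numbers p vp.
Let vpV : valuation vp := padic_numbers_valuation QpP.

Lemma veq_int (z : int) : z != 0 -> veq vp (logn p `|z|%N) (z%:~R : Qp).
Proof.
move=> z0; rewrite /veq -ratr_int (padic_numbers_rat QpP) /padic_valuation_rat.
by rewrite intr_eq0 (negbTE z0) numq_int denq_int logn1 subr0.
Qed.

Lemma veq_p : veq vp 1 (p%:R : Qp).
Proof.
have := @veq_int p%:Z; rewrite logn_prime // eqxx => h; apply: h.
by rewrite -lt0n prime_gt0.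
Qed.

Lemma intr_Qp_neq0 (z : int) : z != 0 -> (z%:~R : Qp) != 0.
Proof. by move=> /veq_int/(veq_neq0 vpV). Qed.

Lemma natr_Qp_neq0 (k : nat) : (0 < k)%N -> (k%:R : Qp) != 0.
Proof. by move=> k0; apply: (@intr_Qp_neq0 k%:Z); lia. Qed.

(** [ratr] is a priori not a ring morphism into a field that is not ordered; in Qp it is
    one because denominators have a finite valuation, so are nonzero. *)
Lemma ratr_Qp_frac (a : rat) (m d : int) :
  a * d%:~R = m%:~R -> ratr a * d%:~R = m%:~R :> Qp.
Proof.
move=> adm; have den0 := intr_Qp_neq0 (denq_neq0 a).
have e : numq a * d = m * denq a.
  by apply: (@intr_inj rat); rewrite !rmorphM /= numqE -adm mulrAC.
by rewrite /ratr mulrAC -intrM e intrM mulfK.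
Qed.

Lemma ratr_QpB (a b : rat) : ratr (a - b) = ratr a - ratr b :> Qp.
Proof.
have a0 := intr_Qp_neq0 (denq_neq0 a); have b0 := intr_Qp_neq0 (denq_neq0 b).
have := @ratr_Qp_frac (a - b) (numq a * denq b - numq b * denq a) (denq a * denq b).
rewrite !intrB !intrM !numqE => h.
have {}h : ratr (a - b) * ((denq a)%:~R * (denq b)%:~R) =
   (numq a)%:~R * (denq b)%:~R - (numq b)%:~R * (denq a)%:~R :> Qp by apply: h; ring.
apply: (mulIf (mulf_neq0 a0 b0)); rewrite h /ratr.
by field; rewrite a0 b0.
Qed.

Lemma ratr_Qp0 : ratr 0 = 0 :> Qp.
Proof. by rewrite -(subrr 0) ratr_QpB subrr. Qed.

Lemma ratr_QpD (a b : rat) : ratr (a + b) = ratr a + ratr b :> Qp.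
Proof. by rewrite -{1}[b]opprK ratr_QpB -[- b]sub0r ratr_QpB ratr_Qp0 sub0r opprK. Qed.

Lemma vge_rat0 (a : rat) : vge vp 0 (ratr a : Qp) -> ~~ (p %| `|denq a|)%N.
Proof.
rewrite /vge (padic_numbers_rat QpP) /padic_valuation_rat.
case: eqVneq => [-> _|a0]; first by rewrite -(mulr0z 1) denq_int /= Euclid_dvd1.
rewrite lee_fin subr_ge0 lez_nat => h; apply/negP => pd.
have den0 : (0 < `|denq a|)%N by rewrite absz_gt0 denq_neq0.
have num0 : (0 < `|numq a|)%N by rewrite absz_gt0 numq_eq0.
have : (0 < logn p `|numq a|)%N.
  by apply: leq_trans h; rewrite logn_gt0 mem_primes p_prime den0.
rewrite logn_gt0 mem_primes => /and3P[_ _ pn].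
have : (p %| gcdn `|numq a| `|denq a|)%N by rewrite dvdn_gcd pn.
by rewrite (eqP (coprime_num_den a)) Euclid_dvd1.
Qed.

(** Density of the natural numbers in Zp: a rational approximation of x has a
    denominator prime to p, which is invertible modulo p^j by a Bezout relation. *)
Lemma approx_nat (x : Qp) (j : nat) : vge vp 0 x ->
  exists2 k : nat, (k < p ^ j)%N & vge vp j (x - k%:R).
Proof.
move=> x0; have [a ha] := padic_numbers_dense QpP x j%:Z.
have a0 : vge vp 0 (ratr a : Qp).
  rewrite -[ratr a](subKr x); apply: vgeB => //.
  by apply: vge_le ha; lia.
have pj0 : (p ^ j)%:Z != 0 :> int by rewrite -lt0n expn_gt0 prime_gt0.
have /coprimezP[[u w] /= uw] : coprimez (denq a) (p ^ j)%:Z.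
  rewrite /coprimez /gcdz; have := vge_rat0 a0; rewrite -prime_coprime //.
  by move=> /(coprimeXl j); rewrite coprime_sym => /eqP /= ->.
have [k kE] : exists k : nat, k%:Z = ((numq a * u) %% (p ^ j)%:Z)%Z.
  by exists `|((numq a * u) %% (p ^ j)%:Z)%Z|%N; rewrite gez0_abs ?modz_ge0.
exists k.
  by rewrite -ltz_nat kE ltz_pmod // ltz_nat expn_gt0 prime_gt0.
apply: (vge_trans vpV ha); rewrite -/(vge _ _ _).
have den0 := intr_Qp_neq0 (denq_neq0 a).
have pjE : ((p ^ j)%:Z)%:~R = p%:R ^+ j :> Qp by rewrite -natrX.
pose q := ((numq a * u) %/ (p ^ j)%:Z)%Z.
have -> : ratr a - k%:R = p%:R ^+ j * (((q)%:~R + ratr a * w%:~R) : Qp).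
  have -> : (k%:R : Qp) = (numq a * u)%:~R - q%:~R * p%:R ^+ j.
    have -> : numq a * u = q * (p ^ j)%:Z + k%:Z by rewrite kE -divz_eq.
    by rewrite intrD intrM pjE addrC addKr.
  have uw' : u%:~R * (denq a)%:~R + w%:~R * p%:R ^+ j = 1 :> Qp.
    by rewrite -pjE -!intrM -intrD uw.
  have raE : ratr a = ratr a * (u%:~R * (denq a)%:~R + w%:~R * p%:R ^+ j) :> Qp.
    by rewrite uw' mulr1.
  by rewrite {1}raE intrM /ratr; field.
apply: (vgeM0 vpV).
  by have := veqX vpV j veq_p => /veq_vge; rewrite mul1r.
have int0 (z : int) : vge vp 0 (z%:~R : Qp).
  have [->|/veq_int h] := eqVneq z 0; first by rewrite vge0.
  by rewrite (vge_veq _ h).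
by apply: vgeD => //; apply: vgeM0.
Qed.

Definition p_fraction (a : rat) : Prop := exists (m : int) (k : nat), a = m%:~R / p%:R ^+ k.

Lemma p_fractionB a b : p_fraction a -> p_fraction b -> p_fraction (a - b).
Proof.
move=> [m [k ->]] [m' [k' ->]]; exists (m * p%:Z ^+ k' - m' * p%:Z ^+ k), (k + k')%N.
have p0 : (p%:R : rat) != 0 by rewrite pnatr_eq0 -lt0n prime_gt0.
rewrite intrB !intrM !rmorphXn /= exprD.
by field; rewrite !expf_neq0.
Qed.

(** Z[1/p] and Zp meet in Z: this makes the class of a representative modulo Z
    unique, hence the p-adic exponential well defined. *)
Lemma p_fraction_int a : p_fraction a -> vge vp 0 (ratr a : Qp) ->
  exists z : int, a = z%:~R.
Proof.
move=> [m [k aE]] /vge_rat0 pd; exists (numq a).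
have p0 : (p%:R : rat) != 0 by rewrite pnatr_eq0 -lt0n prime_gt0.
have e : numq a * (p ^ k)%:Z = m * denq a.
  apply: (@intr_inj rat); rewrite !rmorphM /= numqE mulrAC; congr (_ * _).
  have -> : ((p ^ k)%:Z)%:~R = p%:R ^+ k :> rat by rewrite -natrX.
  by rewrite {1}aE divfK // expf_neq0.
have : (`|denq a| %| `|numq a| * p ^ k)%N.
  by rewrite -[(p ^ k)%N]/(`|(p ^ k)%:Z|%N) -abszM e abszM dvdn_mull.
rewrite Gauss_dvdr; last by rewrite coprime_sym coprime_num_den.
move=> dp; have : coprime `|denq a| (p ^ k).
  by rewrite coprime_sym coprimeXl // prime_coprime.
rewrite /coprime => /eqP; rewrite (gcdn_idPl dp) => d1.
have : denq a = 1 by have := denq_gt0 a; lia.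
by move=> d1'; rewrite numqE d1' mulr1.
Qed.

Lemma p_fraction_ex (x : Qp) :
  exists a, p_fraction a /\ vge vp 0 (x - ratr a).
Proof.
have [m xm] := vge_ex x vpV.
have pX0 (k : nat) : (p%:R ^+ k : Qp) != 0 by rewrite -natrX natr_Qp_neq0 // expn_gt0 prime_gt0.
have vpX := veqX vpV `|m|%N veq_p; rewrite mul1r in vpX.
have [|k _ hk] := @approx_nat (p%:R ^+ `|m|%N * x) `|m|%N.
  by rewrite (vge_mulr_veq vpV _ _ vpX); apply: vge_le xm; lia.
exists (k%:~R / p%:R ^+ `|m|%N); split; first by exists k%:Z, `|m|%N.
have aE : ratr (k%:~R / p%:R ^+ `|m|%N : rat) = k%:R / p%:R ^+ `|m|%N :> Qp.
  apply: (canRL (mulfK (pX0 _))).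
  have := @ratr_Qp_frac (k%:~R / p%:R ^+ `|m|%N) k (p%:Z ^+ `|m|%N).
  rewrite !rmorphXn /= => -> //; rewrite divfK // expf_neq0 //.
  by rewrite pnatr_eq0 -lt0n prime_gt0.
move: hk; have -> : p%:R ^+ `|m|%N * x - k%:R =
    p%:R ^+ `|m|%N * (x - ratr (k%:~R / p%:R ^+ `|m|%N)).
  by rewrite aE mulrBr [_ * (_ / _)]mulrC divfK.
by rewrite (vge_mulr_veq vpV _ _ vpX) subrr.
Qed.

Section Circle.
Variable R : realType.

Definition circle (t : R) : R[i] := Complex (cos (2 * pi * t)) (sin (2 * pi * t)).

Lemma circleD s t : circle (s + t) = circle s * circle t.
Proof.
rewrite /circle mulrDr cosD sinD; congr Complex; rewrite addrC; congr (_ + _).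
Qed.

Lemma circle_int (z : int) : circle z%:~R = 1.
Proof.
have nat1 (k : nat) : circle k%:R = 1.
  rewrite /circle -[2 * pi * k%:R]add0r (mulr_natl pi 2) mulr_natr.
  by rewrite (periodicn (@cosD2pi R)) (periodicn (@sinD2pi R)) cos0 sin0.
case: z => k; first exact: nat1.
rewrite NegzE -[LHS]mulr1 -[X in _ * X](nat1 k.+1) -circleD.
by rewrite intrN addNr; exact: (nat1 0%N).
Qed.

(** The chosen representative can be replaced by any other one, as they differ by an
    integer. *)
Lemma padic_expE (x : Qp) a : p_fraction a -> vge vp 0 (x - ratr a) ->
  padic_exp R p vp x = circle (ratr a).
Proof.
move=> pa xa; rewrite /padic_exp -/(circle _).
have : (exists (m : int) (k : nat), padic_frac p vp x = m%:~R / p%:R ^+ k) /\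
      vge vp 0 (x - ratr (padic_frac p vp x)).
  rewrite /padic_frac; case: xgetP => [b _ //|h].
  by case: (h a); split.
move: (padic_frac p vp x) => b [pb xb].
have [|z zE] := p_fraction_int (p_fractionB pb pa).
  rewrite ratr_QpB.
  have -> : ratr b - ratr a = (x - ratr a) - (x - ratr b) by ring.
  exact: vgeB.
have -> : b = a + z%:~R by rewrite -zE addrC subrK.
by rewrite rmorphD circleD /= ratr_int circle_int mulr1.
Qed.

Lemma padic_expD (x y : Qp) :
  padic_exp R p vp (x + y) = padic_exp R p vp x * padic_exp R p vp y.
Proof.
have [a [pa xa]] := p_fraction_ex x; have [b [pb yb]] := p_fraction_ex y.
rewrite (padic_expE pa xa) (padic_expE pb yb) -circleD -rmorphD.
apply: padic_expE.
  have -> : a + b = a - (0 - b) by ring.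
  do 2!apply: p_fractionB => //; exists 0, 0%N; by rewrite mul0r.
by rewrite ratr_QpD opprD addrACA; apply: vgeD.
Qed.

Lemma padic_exp_int (x : Qp) : vge vp 0 x -> padic_exp R p vp x = 1.
Proof.
move=> x0; rewrite (@padic_expE x 0); first by rewrite rmorph0; exact: (circle_int 0).
  by exists 0, 0%N; rewrite mul0r.
by rewrite ratr_Qp0 subr0.
Qed.

(** The cosine of 2 pi / p is not 1, as 0 < 2 pi / p <= pi. *)
Lemma padic_exp_neq1 : padic_exp R p vp (p%:R^-1) != 1.
Proof.
have p0 : (p%:R : Qp) != 0 by rewrite natr_Qp_neq0 // prime_gt0.
have p0' : (p%:R : rat) != 0 by rewrite pnatr_eq0 -lt0n prime_gt0.
rewrite (@padic_expE _ (p%:R^-1)).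
- apply/eqP => -[cos1 _]; have {}cos1 := etrans cos1 (esym (cos0 R)); move: cos1.
  have p1 : 2 <= p%:R :> R by rewrite ler_nat prime_gt1.
  have pi0 := pi_gt0 R.
  have p0R : 0 < (p%:R : R)^-1 by rewrite invr_gt0; lra.
  have -> : ratr p%:R^-1 = p%:R^-1 :> R by rewrite fmorphV /= ratr_nat.
  move=> /cos_inj.
  rewrite !in_itv /= lexx (ltW pi0) /= => h.
  have : 2 * pi * p%:R^-1 = 0 :> R.
    apply: h => //; rewrite mulr_ge0 /=; [|lra|exact: ltW].
    rewrite ler_pdivrMr; nra.
  by move=> /eqP; rewrite !mulf_eq0; lra.
- by exists 1, 1%N; rewrite expr1 mul1r.
suff -> : ratr p%:R^-1 = p%:R^-1 :> Qp by rewrite subrr vge0.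
have := @ratr_Qp_frac p%:R^-1 1 p%:Z; rewrite mulVf // => /(_ erefl) h.
by apply: (mulIf p0); rewrite mulVf.
Qed.

End Circle.
End PadicExponential.

(** * Neighbourhoods in a valued field and in its powers *)

Lemma nbhs_valued (K : fieldType) (v : K -> \bar int) (vV : valuation v)
    (x : valued v) (U : set (valued v)) :
  nbhs x U <-> exists m : int, forall y : K, vge v m (y - x) -> U y.
Proof.
rewrite nbhsE; split.
  move=> [V [Vo Vx] VU]; have [k hk] := Vo x Vx.
  by exists k => y /hk; apply: VU.
move=> [k hk]; exists [set y : valued v | vge v k (y - x)] => //.
split; last by rewrite /= subrr vge0.
move=> y /= yx; exists k => z zy; exact: (vge_trans vV zy yx).
Qed.

Lemma nbhs_rV (K : fieldType) (v : K -> \bar int) (vP : valuation v) (m : nat)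
     (x : 'rV[valued v]_m) (U : set 'rV[valued v]_m) :
  nbhs x U <-> exists k : nat, forall y : 'rV[valued v]_m,
    (forall i, vge v k (y 0 i - x 0 i)) -> U y.
Proof.
split.
  move=> [P Px PU]; have /choice[k hk] : forall i, exists k : int, forall y : K,
      vge v k (y - x 0 i) -> P 0 i y.
    by move=> i; apply/(nbhs_valued vP); exact: Px.
  exists (\max_i `|k i|)%N => y hy; apply: PU => j i.
  rewrite ord1; apply: hk; apply: vge_le (hy i).
  by have := leq_bigmax (F := fun i => `|k i|%N) i; lia.
move=> [k hk]; exists (fun _ i => [set y : valued v | vge v k (y - x 0 i)]).
  by move=> j i; apply/(nbhs_valued vP); exists k => y; rewrite ord1.
by move=> y hy; apply: hk => i; exact: hy.
Qed.

(** * Trace, standard character and compactness of the valuation ring *)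

Section LocalField.
Variables (p : nat) (Qp : fieldType) (vp : Qp -> \bar int).
Hypothesis p_prime : prime p.
Hypothesis QpP : padic_numbers p vp.
Variables (K : fieldExtType Qp) (v : K -> \bar int).
Hypothesis vP : padic_valuation vp v.

Let vpV : valuation vp := padic_numbers_valuation QpP.
Let vV : valuation v := padic_valuation_valuation vP.
Let m := \dim {:K}.
Let b (i : 'I_m) : K := (vbasis {:K})`_i.
Let x_ (i : 'I_m) (x : K) : Qp := coord (vbasis {:K}) i x.

Let xE x : x = \sum_i x_ i x *: b i.
Proof. exact: (coord_vbasis (memvf x)). Qed.

Lemma coord_vbasis_bound : exists C : int, forall x M, vge v M x ->
  forall i, vge v (M - C) (x_ i x)%:A.
Proof.
have [|C hC] := coord_bound QpP vP (b := fun i => (vbasis {:K})`_i) (m := m).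
  move=> a a0 i im.
  have /freeP free_b := basis_free (vbasisP {:K}).
  exact: (free_b (fun i : 'I_m => a i) a0 (Ordinal im)).
exists C => x M xM i.
have := hC (fun i => if insub i is Some j then x_ j x else 0) M _ i (ltn_ord i).
rewrite valK; apply; rewrite (eq_bigr (fun i => x_ i x *: b i)) -?xE // => j _.
by rewrite valK.
Qed.

Lemma field_traceP (a : Qp) (x y : K) :
  field_trace (a *: x + y) = a * field_trace x + field_trace y.
Proof.
by rewrite /field_trace amull_is_linear passmx.mxof_linear mxtraceD mxtraceZ.
Qed.

Lemma field_traceD (x y : K) : field_trace (x + y) = field_trace x + field_trace y.
Proof. by have := field_traceP 1 x y; rewrite scale1r mul1r. Qed.

Lemma field_trace0 : field_trace (0 : K) = 0.
Proof.
have /eqP := field_traceD 0 0.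
by rewrite addr0 -{1}[field_trace 0]addr0 (inj_eq (addrI _)) => /eqP.
Qed.

Lemma field_traceZ (a : Qp) (x : K) : field_trace (a *: x) = a * field_trace x.
Proof. by have := field_traceP a x 0; rewrite field_trace0 !addr0. Qed.

Lemma field_trace1 : field_trace (1 : K) = m%:R.
Proof.
by rewrite /field_trace amull1 passmx.mxof1 ?mxtrace1 // (basis_free (vbasisP _)).
Qed.

(** Continuity of the trace, read off from the bound on coordinates. *)
Lemma field_trace_bound : exists d : int, forall x : K,
  vge v d x -> vge vp 0 (field_trace x).
Proof.
have [C hC] := coord_vbasis_bound; have [e e0 vE] := vge_alg QpP vP.
have [t ht] := vge_ex_fin (fun i => field_trace (b i)) vpV.
exists (C - e%:Z * t) => x xd.
have -> : field_trace x = \sum_i x_ i x * field_trace (b i).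
  rewrite {1}(xE x) (big_morph _ field_traceD (_ : field_trace 0 = 0)).
    by apply: eq_bigr => i _; rewrite field_traceZ.
  exact: field_trace0.
apply: vge_sum => // i _; rewrite -(addNr t); apply: vgeM => //.
by rewrite -vE; apply: vge_le (hC _ _ xd i); lia.
Qed.

Lemma std_charD (R : realType) (x y : K) :
  std_char R p vp (x + y) = std_char R p vp x * std_char R p vp y.
Proof. by rewrite /std_char field_traceD (padic_expD p_prime QpP). Qed.

Lemma std_char_conductor (R : realType) : exists d : int, forall x : K,
  vge v d x -> std_char R p vp x = 1.
Proof.
have [d hd] := field_trace_bound; exists d => x /hd h.
exact: (padic_exp_int p_prime QpP).
Qed.

(** As the characteristic is zero, 1 / p is the trace of 1 / (p [K : Qp]). *)
Lemma std_char_neq1 (R : realType) : exists z : K, std_char R p vp z != 1.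
Proof.
exists ((p%:R * m%:R)^-1 *: 1); rewrite /std_char field_traceZ field_trace1.
rewrite invfM divfK ?(padic_exp_neq1 p_prime QpP) //.
apply: (natr_Qp_neq0 p_prime QpP); rewrite lt0n dimv_eq0.
by rewrite -subv0; apply/negP => /subvP/(_ _ (memvf 1)); rewrite memv0 oner_eq0.
Qed.

Lemma vlt0_vge1 x : (0 < v x)%E = vge v 1 x.
Proof.
rewrite /vge; have [->|/(v_fin vV)[k ->]] := eqVneq x 0.
  by rewrite (valuation0 vV) ltey leey.
by rewrite lte_fin lee_fin; lia.
Qed.

(** The coordinates of an integral element have bounded denominators, and
    changing them modulo a high power of p does not change the residue class; so
    finitely many coordinate vectors reach all classes. *)
Lemma residue_field_finite : finite_set (residue_field v).
Proof.
have [C hC] := coord_vbasis_bound; have [e e0 vE] := vge_alg QpP vP.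
have [t ht] := vge_ex_fin b vV.
pose c := `|C|%N; pose j := (c + (`|t| + 1))%N.
have vX : veq vp c (p%:R ^+ c) by have := veqX vpV c (veq_p p_prime QpP); rewrite mul1r.
have pc0 := veq_neq0 vpV vX.
pose cls (x : K) : set K := [set y | val_ring v y /\ (0 < v (y - x)%R)%E].
pose y_ (f : {ffun 'I_m -> 'I_(p ^ j)}) : K :=
  \sum_i ((f i)%:R / p%:R ^+ c) *: b i.
apply: (@sub_finite_set _ _ [set cls (y_ f) | f in setT]); last exact: finite_image.
move=> _ [x x0 <-].
have /choice[f hf] : forall i, exists k : 'I_(p ^ j), vge vp j (p%:R ^+ c * x_ i x - k%:R).
  move=> i; have [|k kj hk] := @approx_nat _ _ _ p_prime QpP (p%:R ^+ c * x_ i x) j.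
    rewrite (vge_mulr_veq vpV _ _ vX) -vE; apply: vge_le (hC _ 0 x0 i).
    by have := leq_pmull c e0; rewrite -lez_nat PoszM /c; lia.
  by exists (Ordinal kj).
have xy : vge v 1 (x - y_ [ffun i => f i]).
  rewrite {1}(xE x) /y_ -sumrB; apply: vge_sum => // i _.
  rewrite -scalerBl scale_alg ffunE.
  have : vge vp (`|t| + 1)%N%:Z (x_ i x - (f i)%:R / p%:R ^+ c).
    have := hf i; have -> : p%:R ^+ c * x_ i x - (f i)%:R =
        p%:R ^+ c * (x_ i x - (f i)%:R / p%:R ^+ c).
      by rewrite mulrBr [_ * (_ / _)]mulrC divfK.
    by rewrite (vge_mulr_veq vpV _ _ vX); apply: vge_le; rewrite /j; lia.
  rewrite -vE => /(vgeM vV)/(_ (ht i)); apply: vge_le.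
  by have := leq_pmull (`|t| + 1) e0; rewrite -lez_nat PoszM; lia.
exists [ffun i => f i] => //; apply/seteqP.
split=> z [z0]; rewrite vlt0_vge1 => h; split => //; rewrite vlt0_vge1.
  by apply: (vge_trans vV h); rewrite vge_subC.
exact: (vge_trans vV h xy).
Qed.


(** One element is chosen in each residue class; here the residue cardinality,
    defined through the set of classes, becomes the length of a list. *)
Lemma residue_system_ex :
  exists2 A : seq K, size A = residue_card v & residue_system v A.
Proof.
pose repr (X : set K) := xget 0 X.
have memF X : (X \in (fset_set (residue_field v) : seq _)) = (X \in residue_field v).
  exact: (in_fset_set residue_field_finite).
have clsP X : residue_field v X -> vge v 0 (repr X) /\
    X = [set y | val_ring v y /\ (0 < v (y - repr X)%R)%E].
  move=> [x x0 XE]; have : X (repr X).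
    by rewrite /repr; case: xgetP => // /(_ x) []; rewrite -XE /= subrr vlt0_vge1 vge0.
  rewrite -{1}XE => -[r0]; rewrite vlt0_vge1 => rx; split=> //.
  rewrite -{1}XE; apply/seteqP; split=> z /=; rewrite !vlt0_vge1 => -[z0 h]; split=> //.
    by apply: (vge_trans vV h); rewrite vge_subC.
  exact: (vge_trans vV h).
have repr_inj X Y : residue_field v X -> residue_field v Y ->
    vge v 1 (repr X - repr Y) -> X = Y.
  move=> /clsP[_ XE] /clsP[_ YE] h; rewrite XE YE; apply/seteqP.
  split=> z /=; rewrite !vlt0_vge1 => -[z0 zh]; split=> //.
    exact: (vge_trans vV zh).
  by apply: (vge_trans vV zh); rewrite vge_subC.
exists [seq repr X | X <- (fset_set (residue_field v) : seq _)].
  by rewrite size_map.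
split.
- by move=> _ /mapP[X + ->]; rewrite memF => /set_mem/clsP[].
- rewrite map_inj_in_uniq ?fset_uniq // => X Y; rewrite !memF => /set_mem hX /set_mem hY e.
  by apply: repr_inj => //; rewrite e subrr vge0.
- move=> _ _ /mapP[X + ->] /mapP[Y + ->]; rewrite !memF => /set_mem hX /set_mem hY h.
  by congr repr; apply: repr_inj.
move=> x x0; have hX : residue_field v [set y | val_ring v y /\ (0 < v (y - x)%R)%E] by exists x.
exists (repr [set y | val_ring v y /\ (0 < v (y - x)%R)%E]).
  apply/mapP; exists [set y | val_ring v y /\ (0 < v (y - x)%R)%E] => //.
  by rewrite memF; apply: mem_set.
have [_ /seteqP[h _]] := clsP _ hX.
by have := h x; rewrite /= subrr !vlt0_vge1 vge0 // => -[].
Qed.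

Lemma residue_card_gt1 : (1 < residue_card v)%N.
Proof.
have [A <- [_ _ _ onto]] := residue_system_ex.
have [a aA a0] := onto 0 (vge0 vV 0); have [b' bA b1] := onto 1 (veq_vge (veq1 vV)).
case: A aA bA {onto} => [|c [|c' A]] //; rewrite !inE => /eqP ? /eqP ?; subst a b'.
have : vge v 1 (1 - 0 : K) by have := vgeB vV b1 a0; rewrite opprB addrA subrK.
by rewrite subr0 (vge_veq _ (veq1 vV)).
Qed.

Lemma valued_complete (u : nat -> K) :
  (forall N k k' : nat, (N <= k)%N -> (N <= k')%N -> vge v N (u k - u k')) ->
  exists l, forall M : int, exists N, forall k, (N <= k)%N -> vge v M (u k - l).
Proof.
move=> cauchy; have [C hC] := coord_vbasis_bound; have [e e0 vE] := vge_alg QpP vP.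
have /choice[l hl] : forall i : 'I_m, exists l : Qp, forall M : int, exists N,
    forall k, (N <= k)%N -> vge vp M (x_ i (u k) - l).
  move=> i; have [|l hl] := padic_numbers_complete QpP (u := fun k => x_ i (u k)).
    move=> M; exists `|(e%:Z * M + C)%R|%N => k k' hk hk'.
    have := hC _ _ (cauchy _ _ _ hk hk') i; rewrite /x_ linearB /=.
    rewrite -[(_ <= _)%E]/(vge vp M _) -vE; apply: vge_le; lia.
  by exists l.
exists (\sum_i l i *: b i) => M.
have [t ht] := vge_ex_fin b vV.
have /choice[N hN] : forall i, exists N, forall k, (N <= k)%N ->
    vge vp `|M - t| (x_ i (u k) - l i) by move=> i; exact: hl.
exists (\max_i N i) => k hk; rewrite {1}(xE (u k)) -sumrB.
apply: vge_sum => // i _; rewrite -scalerBl scale_alg.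
have := hN i k (leq_trans (leq_bigmax i) hk); rewrite -vE => /(vgeM vV)/(_ (ht i)).
apply: vge_le.
by have := leq_pmull `|(M - t)%R|%N e0; rewrite -lez_nat PoszM; lia.
Qed.

(** An ultrafilter on R contains, for each r, exactly one class modulo pi^r as there
    are finitely many; these classes shrink to a point by completeness. *)
Lemma compact_val_ring : compact (val_ring v : set (valued v)).
Proof.
have [A _ AP] := residue_system_ex.
have [w w1] := padic_valuation_onto vP.
have {}w1 : veq v 1 w by apply/eqP.
rewrite compact_ultra => F FU FR.
have pick (s : seq K) (B : K -> set (valued v)) :
    F [set x | exists2 t, t \in s & B t x] -> exists2 t, t \in s & F (B t).
  elim: s => [|t s IH] hF.
    by have [x []] := filter_ex hF.
  have [|hn] := in_ultra_setVsetC (B t) FU; first by exists t; rewrite ?mem_head.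
  have [|t' ts Ft'] := IH; last by exists t' => //; rewrite inE ts orbT.
  apply: filterS (filterI hF hn) => x [[t']]; rewrite inE => /orP[/eqP ->|] //.
  by exists t'.
have /choice[t ht] : forall r : nat, exists t : K, F [set x : valued v | vge v r (x - t)].
  move=> r; have [|t _ Ft] := pick (digits w A r) (fun t => [set x | vge v r (x - t)]).
    by apply: filterS FR => x /(digits_onto vV w1 AP r)[t tr h]; exists t.
  by exists t.
have [N k k' Nk Nk'|l hl] := @valued_complete t.
  have [x [/= hx hx']] := filter_ex (filterI (ht k) (ht k')).
  have -> : t k - t k' = (x - t k') - (x - t k) by ring.
  by apply: vgeB => //; [apply: vge_le hx'|apply: vge_le hx]; rewrite lez_nat.
have Fl M : F [set x : valued v | vge v M (x - l)].
  have [N hN] := hl M; pose k := maxn N `|M|%N.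
  apply: filterS (ht k) => x /= hx.
  have {}hx : vge v M (x - t k) by apply: vge_le hx; rewrite /k; lia.
  by apply: (vge_trans vV hx); apply: hN; rewrite leq_maxl.
exists l; split.
  have [x [/= x0 hx]] := filter_ex (filterI FR (Fl 0)).
  by rewrite /val_ring /= -[l](subKr x) -/(vge v 0 _); apply: vgeB.
by move=> U /(nbhs_valued vV)[k hk]; apply: filterS (Fl k) => x /hk.
Qed.

End LocalField.

(** * Restriction of polynomials to lines *)

Section LinePolynomials.
Variables (K : fieldType) (v : K -> \bar int).
Hypothesis vP : valuation v.
Local Notation vge := (vge v).
Local Notation veq := (veq v).
Local Notation gauss_ge := (gauss_ge v).
Variable n : nat.

Definition mgauss_ge (M : int) (h : mpoly n K) : Prop :=
  forall m, vge M (mcoeff m h).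

Lemma mgauss_ex (h : mpoly n K) : exists M, mgauss_ge M h.
Proof.
have [M hM] := vge_ex_fin (fun i : 'I_(size (msupp h)) => mcoeff (nth mnm0 (msupp h) i) h) vP.
exists M => m; have [mh|/memN_msupp_eq0 ->] := boolP (m \in msupp h); last by rewrite vge0.
have im : (index m (msupp h) < size (msupp h))%N by rewrite index_mem.
by have := hM (Ordinal im); rewrite /= nth_index.
Qed.

(** The polynomial h (x + T e) in one variable T. *)
Definition line_poly (h : mpoly n K) (x e : 'I_n -> K) : {poly K} :=
  mmap polyC (fun j => (x j)%:P + e j *: 'X) h.

Lemma horner_line_poly h x e t :
  (line_poly h x e).[t] = meval (fun j => x j + e j * t) h.
Proof.
rewrite /line_poly /meval /mmap -[LHS]/(horner_eval t _) raddf_sum.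
apply: eq_bigr => m _; rewrite /= /horner_eval hornerM hornerC; congr (_ * _).
rewrite /mmap1 -[LHS]/(horner_eval t _) rmorph_prod; apply: eq_bigr => i _.
by rewrite /= /horner_eval horner_exp !hornerE.
Qed.

Let mmap1_line (x e : 'I_n -> K) (m : multinom n) := mmap1 (fun j => (x j)%:P + e j *: 'X) m.

Lemma gauss_line_factor x e : vge 0 x -> vge 0 e -> gauss_ge 0 (x%:P + e *: 'X).
Proof.
move=> x0 e0; apply: gauss_geD => //; first exact: gauss_geC.
rewrite -(addr0 (0 : int)); apply: gauss_geZ => //.
by move=> j; rewrite coefX; apply: vge_nat.
Qed.

Lemma gauss_mmap1 (x e : 'I_n -> K) (m : multinom n) :
  (forall j, vge 0 (x j)) -> (forall j, vge 0 (e j)) -> gauss_ge 0 (mmap1_line x e m).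
Proof.
move=> x0 e0; rewrite /mmap1_line /mmap1; elim/big_ind: _ => [|P Q hP hQ|i _].
- by apply: gauss_geC => //; apply: veq_vge; rewrite veq1.
- by have := gauss_geM vP hP hQ; rewrite addr0.
by apply: gauss_geX => //; apply: gauss_line_factor.
Qed.

Lemma gauss_mul_sub s (P Q P' Q' : {poly K}) :
  gauss_ge 0 P -> gauss_ge 0 Q' ->
  gauss_ge s (P - P') -> gauss_ge s (Q - Q') -> gauss_ge s (P * Q - P' * Q').
Proof.
move=> P0 Q0 hP hQ.
have -> : P * Q - P' * Q' = P * (Q - Q') + (P - P') * Q' by ring.
apply: gauss_geD => //; [rewrite -(add0r s)|rewrite -(addr0 s)]; exact: gauss_geM.
Qed.

Lemma gauss_mmap1_sub s (x x' e : 'I_n -> K) (m : multinom n) :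
  (forall j, vge 0 (x j)) -> (forall j, vge 0 (x' j)) -> (forall j, vge 0 (e j)) ->
  (forall j, vge s (x j - x' j)) ->
  gauss_ge s (mmap1_line x e m - mmap1_line x' e m).
Proof.
move=> x0 x'0 e0 xx'; rewrite /mmap1_line /mmap1.
have fac j k : [/\ gauss_ge 0 (((x j)%:P + e j *: 'X) ^+ k),
   gauss_ge 0 (((x' j)%:P + e j *: 'X) ^+ k) &
   gauss_ge s (((x j)%:P + e j *: 'X) ^+ k - ((x' j)%:P + e j *: 'X) ^+ k)].
  split; [by apply: gauss_geX => //; apply: gauss_line_factor..|].
  elim: k => [|k IH]; first by rewrite subrr; apply: gauss_ge0.
  rewrite !exprS; apply: gauss_mul_sub => //.
  - exact: gauss_line_factor.
  - by apply: gauss_geX => //; apply: gauss_line_factor.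
  by rewrite opprD addrACA subrr addr0 -polyCB; apply: gauss_geC.
suff [] : [/\ gauss_ge 0 (\prod_(i < n) ((x i)%:P + e i *: 'X) ^+ m i),
    gauss_ge 0 (\prod_(i < n) ((x' i)%:P + e i *: 'X) ^+ m i) &
    gauss_ge s (\prod_(i < n) ((x i)%:P + e i *: 'X) ^+ m i -
      \prod_(i < n) ((x' i)%:P + e i *: 'X) ^+ m i)] by [].
elim/big_ind2: _ => [|P P' Q Q' [h1 h2 h3] [g1 g2 g3]|i _]; last exact: fac.
  have h1 : gauss_ge 0 1 by apply: gauss_geC => //; apply: veq_vge; rewrite veq1.
  by split => //; rewrite subrr; apply: gauss_ge0.
split; last exact: gauss_mul_sub.
- by have := gauss_geM vP h1 g1; rewrite addr0.
- by have := gauss_geM vP h2 g2; rewrite addr0.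
Qed.

Lemma gauss_line_poly M (h : mpoly n K) (x e : 'I_n -> K) :
  (forall j, vge 0 (x j)) -> (forall j, vge 0 (e j)) ->
  mgauss_ge M h -> gauss_ge M (line_poly h x e).
Proof.
move=> x0 e0 hM; rewrite /line_poly /mmap; apply: gauss_ge_sum => // m.
rewrite -(addr0 M); apply: gauss_geM => //; first exact: gauss_geC.
exact: gauss_mmap1.
Qed.

(** Continuity of the coefficients of h (x + T e) in the base point x, for the Gauss
    norm. *)
Lemma gauss_line_poly_sub M s (h : mpoly n K) (x x' e : 'I_n -> K) :
  (forall j, vge 0 (x j)) -> (forall j, vge 0 (x' j)) -> (forall j, vge 0 (e j)) ->
  (forall j, vge s (x j - x' j)) ->
  mgauss_ge M h -> gauss_ge (M + s) (line_poly h x e - line_poly h x' e).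
Proof.
move=> x0 x'0 e0 xx' hM; rewrite /line_poly /mmap -sumrB.
apply: gauss_ge_sum => // m; rewrite -mulrBr.
apply: gauss_geM => //; first exact: gauss_geC.
exact: gauss_mmap1_sub.
Qed.

(* F i is the limit of the polynomials h i N, uniformly on the unit ball and at
   a rate that the Gauss norm controls. *)
Variable r : nat.
Variables (h : 'I_r -> nat -> mpoly n K) (F : 'I_r -> ('I_n -> K) -> K).
Hypothesis h_cauchy : forall i (N M : nat), (N <= M)%N -> mgauss_ge N (h i M - h i N).
Hypothesis h_lim : forall i (N : nat) x, (forall j, vge 0 (x j)) ->
  vge N (F i x - meval x (h i N)).

(** Along a line on which the combination of the F i with coefficients u0 is not
    constant, some coefficient of positive degree k is nonzero, and it keeps its
    valuation for all nearby lines and all good enough approximations: the approximating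
    polynomials A depend on the accuracy N, but k, kappa and C do not. *)
Lemma line_approx (u0 : 'I_r -> K) (x0 e : 'I_n -> K) :
  (forall i, vge 0 (u0 i)) -> (forall j, vge 0 (x0 j)) -> (forall j, vge 0 (e j)) ->
  \sum_i u0 i * F i (fun j => x0 j + e j) != \sum_i u0 i * F i x0 ->
  exists (k : nat) (kappa : int) (C s : nat), (0 < k)%N /\
    forall (u : 'I_r -> K) (x : 'I_n -> K),
    (forall i, vge 0 (u i)) -> (forall j, vge 0 (x j)) ->
    (forall i, vge s (u i - u0 i)) -> (forall j, vge s (x j - x0 j)) ->
    forall N : nat, exists A : {poly K}, [/\ veq kappa A`_k, gauss_ge (- C%:Z) A &
      forall t, vge 0 t ->
        vge N (\sum_i u i * F i (fun j => x j + e j * t) - A.[t])].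
Proof.
move=> u00 x00 e0 gneq.
have [C hC] : exists C : nat, forall i N, mgauss_ge (- C%:Z) (h i N).
  have /choice[M hM] : forall i, exists M, mgauss_ge M (h i 0) by move=> i; exact: mgauss_ex.
  exists (\max_i `|M i|)%N => i N m.
  rewrite -[h i N](subrK (h i 0)) mcoeffD; apply: vgeD => //.
    by apply: vge_le (h_cauchy i (leq0n N) m); lia.
  by apply: vge_le (hM i m); have := leq_bigmax (F := fun i => `|M i|%N) i; lia.
pose Q u x N := \sum_i u i *: line_poly (h i N) x e.
have Qlim u x (N : nat) t : (forall i, vge 0 (u i)) -> (forall j, vge 0 (x j)) -> vge 0 t ->
    vge N (\sum_i u i * F i (fun j => x j + e j * t) - (Q u x N).[t]).
  move=> hu hx ht; rewrite /Q horner_sum -sumrB; apply: vge_sum => // i _.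
  rewrite hornerZ horner_line_poly -mulrBr; apply: vge0M => //; apply: h_lim => j.
  by apply: vgeD => //; apply: vge0M.
have Qcauchy u x (N M : nat) : (forall i, vge 0 (u i)) -> (forall j, vge 0 (x j)) ->
    (N <= M)%N -> gauss_ge N (Q u x M - Q u x N).
  move=> hu hx NM; rewrite /Q -sumrB; apply: gauss_ge_sum => // i.
  rewrite -scalerBr -(add0r N%:Z); apply: gauss_geZ => //.
  by rewrite /line_poly -mmapB; apply: gauss_line_poly => //; exact: h_cauchy.
have QC u x N : (forall i, vge 0 (u i)) -> (forall j, vge 0 (x j)) ->
    gauss_ge (- C%:Z) (Q u x N).
  move=> hu hx; apply: gauss_ge_sum => // i.
  by rewrite -(add0r (- C%:Z)); apply: gauss_geZ => //; apply: gauss_line_poly.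
have Qsub s u x N : (forall i, vge 0 (u i)) -> (forall j, vge 0 (x j)) ->
    (forall i, vge s (u i - u0 i)) -> (forall j, vge s (x j - x0 j)) ->
    gauss_ge (s - C%:Z) (Q u x N - Q u0 x0 N).
  move=> hu hx us xs; rewrite /Q -sumrB; apply: gauss_ge_sum => // i.
  have -> : u i *: line_poly (h i N) x e - u0 i *: line_poly (h i N) x0 e =
    (u i - u0 i) *: line_poly (h i N) x e +
    u0 i *: (line_poly (h i N) x e - line_poly (h i N) x0 e).
    by rewrite scalerBl scalerBr addrA subrK.
  apply: gauss_geD => //; first by apply: gauss_geZ => //; apply: gauss_line_poly.
  rewrite -(add0r (s - C%:Z)); apply: gauss_geZ => //; rewrite addrC.
  exact: gauss_line_poly_sub.
have [d vd] : exists d, veq d (\sum_i u0 i * F i (fun j => x0 j + e j) - \sum_i u0 i * F i x0).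
  by apply: (veq_exists vP); rewrite subr_eq0.
(* an approximation finer than the variation of the limit along the line *)
pose N0 := (`|d| + 1)%N.
have v10 : vge 0 1 by apply: veq_vge; rewrite veq1.
(* if all coefficients of positive degree were that small, so would be the
   difference of the values at 1 and 0 *)
have [k k0 hk] : exists2 k, (0 < k)%N & ~~ vge (d + 1) (Q u0 x0 N0)`_k.
  apply: contrapT => hN.
  have {}hN k : (0 < k)%N -> vge (d + 1) (Q u0 x0 N0)`_k.
    by move=> k0; apply: contrapT => /negP h1; apply: hN; exists k.
  have := Qlim u0 x0 N0 1 u00 x00 v10; have := Qlim u0 x0 N0 0 u00 x00 (vge0 vP 0).
  have -> : (fun j => x0 j + e j * 1) = (fun j => x0 j + e j) by apply/funext => j; rewrite mulr1.
  have -> : (fun j => x0 j + e j * 0) = x0 by apply/funext => j; rewrite mulr0 addr0.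
  move=> h0 h1; have Q01 : vge (d + 1) ((Q u0 x0 N0).[1] - (Q u0 x0 N0).[0]).
    rewrite horner_coef0 (horner_coef_wide (n := (size (Q u0 x0 N0)).+1)) //.
    rewrite big_ord_recl /= expr0 mulr1 addrAC subrr add0r; apply: vge_sum => // i _.
    by rewrite expr1n mulr1; apply: hN.
  have : vge (d + 1) (\sum_i u0 i * F i (fun j => x0 j + e j) - \sum_i u0 i * F i x0).
    set a := \sum_i _ in h1 *; set c := \sum_i _ in h0 *.
    have -> : a - c = (a - (Q u0 x0 N0).[1]) - (c - (Q u0 x0 N0).[0]) +
       ((Q u0 x0 N0).[1] - (Q u0 x0 N0).[0]) by ring.
    apply: vgeD => //; apply: vgeB => //; [apply: vge_le h1|apply: vge_le h0]; lia.
  by rewrite (vge_veq _ vd); lia.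
have [kappa vk] : exists kappa, veq kappa (Q u0 x0 N0)`_k.
  by apply: (veq_exists vP); apply: contraNneq hk => ->; rewrite vge0.
have kd : (kappa <= d)%R by move: hk; rewrite (vge_veq _ vk); lia.
exists k, kappa, C, (C + N0)%N; split=> // u x hu hx us xs N.
exists (Q u x (maxn N N0)); split.
- have -> : (Q u x (maxn N N0))`_k = (Q u0 x0 N0)`_k +
    ((Q u x (maxn N N0) - Q u0 x0 (maxn N N0)) + (Q u0 x0 (maxn N N0) - Q u0 x0 N0))`_k.
    by rewrite addrA subrK coefB addrC subrK.
  apply: veqD => //; rewrite coefD; apply: vgeD => //.
    by apply: vge_le (Qsub _ _ _ (maxn N N0) hu hx us xs k); lia.
  by apply: vge_le (Qcauchy _ _ _ _ u00 x00 (leq_maxr N N0) k); lia.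
- exact: QC.
by move=> t ht; apply: vge_le (Qlim u x (maxn N N0) t hu hx ht); rewrite lez_nat leq_maxl.
Qed.

End LinePolynomials.

(** * Dominant polynomial and analytic maps *)

Section PolynomialMaps.
Variables (K : fieldType) (v : K -> \bar int).
Hypothesis vP : valuation v.
Variables (w : K) (n r : nat).
Hypothesis w1 : veq v 1 w.

Definition scale_mpoly (c : K) (f : mpoly n K) : mpoly n K :=
  comp_mpoly [tuple c *: mpolyX K (mnm1 i) | i < n] f.

Lemma meval_scale_mpoly c f (x : 'I_n -> K) :
  meval x (scale_mpoly c f) = meval (fun i => c * x i) f.
Proof.
rewrite comp_mpoly_meval; congr meval; apply/funext => i.
by rewrite tnth_mktuple mevalZ mevalXU.
Qed.

(** A polynomial vanishing on a ball around 0 vanishes on each line through 0, since its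
    restriction to the line has infinitely many zeros. *)
Lemma meval_ball_eq0 (H : mpoly n K) (E : int) :
  (forall x : 'I_n -> K, (forall j, vge v E (x j)) -> meval x H = 0) ->
  forall x, meval x H = 0.
Proof.
move=> H0 x; have [B hB] := vge_ex_fin x vP.
pose L := line_poly H (fun=> 0) x.
have Lt t : L.[t] = meval (fun j => x j * t) H.
  by rewrite horner_line_poly; congr meval; apply/funext => j; rewrite add0r.
suff L0 : L = 0.
  have := Lt 1; rewrite L0 horner0 => ->; congr meval.
  by apply/funext => j; rewrite mulr1.
pose k0 := `|E - B|%N.
apply: (@roots_geq_poly_eq0 _ L [seq w ^+ (k0 + k) | k <- iota 0 (size L)]).
- apply/allP => _ /mapP[k _ ->]; rewrite /root Lt; apply/eqP/H0 => j.
  have := vgeM vP (hB j) (veq_vge (veqX vP (k0 + k) w1)).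
  by apply: vge_le; rewrite /k0; lia.
- rewrite map_inj_uniq ?iota_uniq // => k k' e.
  have h := veqX vP (k0 + k) w1; have h' := veqX vP (k0 + k') w1.
  by rewrite e in h; have := veq_inj h h'; lia.
by rewrite size_map size_iota.
Qed.

(** If sum_i u_i f_i were equal to c on the ball, then also everywhere, and
    sum_i u_i X_i - c would be a nonzero polynomial vanishing on the image of f. *)
Lemma poly_dominant_nonconst (f : 'I_r -> mpoly n K) (E : int) (u : 'I_r -> K) c :
  poly_dominant f -> (exists i, u i != 0) ->
  exists2 x : 'I_n -> K, (forall j, vge v E (x j)) &
    \sum_i u i * meval x (f i) != c.
Proof.
move=> fdom [i ui]; apply: contrapT => hN; apply: fdom.
pose H : mpoly n K := \sum_i u i *: f i - mpolyC n c.
have HE x : meval x H = \sum_i u i * meval x (f i) - c.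
  rewrite /H mevalB mevalC raddf_sum; congr (_ - _).
  by apply: eq_bigr => k _; rewrite /= mevalZ.
have H0 : forall x, meval x H = 0.
  apply: (@meval_ball_eq0 H E) => x hx; rewrite HE; apply/eqP; rewrite subr_eq0.
  by apply: contrapT => /negP h; apply: hN; exists x.
exists (\sum_k u k *: mpolyX K (mnm1 k) - mpolyC r c).
  apply: contraNneq ui => g0; have := congr1 (mcoeff (mnm1 i)) g0.
  rewrite mcoeffB mcoeffC mcoeff0 raddf_sum /= (bigD1 i) //= mcoeffZ mcoeffXU eqxx mulr1.
  rewrite big1 => [|k ki]; last by rewrite mcoeffZ mcoeffXU (negbTE ki) mulr0.
  by rewrite mnm1_eq0 mulr0 subr0 addr0 => ->.
move=> x; rewrite mevalB mevalC raddf_sum /=.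
rewrite -[RHS](H0 (fun j => x 0 j)) HE; congr (_ - _); apply: eq_bigr => k _.
by rewrite mevalZ mevalXU mxE.
Qed.

End PolynomialMaps.

Section AnalyticMaps.
Variables (K : fieldType) (v : K -> \bar int).
Hypothesis vP : valuation v.
Variables (n r : nat).

(** The N-th polynomial keeps the finitely many terms of the power series whose
    coefficient is not divisible by pi^N, rather than those of bounded degree: the
    remainder is then small for the Gauss norm by definition. *)
Lemma restricted_analytic_limit (g : 'rV[valued v]_n -> valued v) :
  restricted_analytic g ->
  exists h : nat -> mpoly n K,
    (forall N M, (N <= M)%N -> mgauss_ge v N (h M - h N)) /\
    (forall (N : nat) (x : 'I_n -> K), (forall j, vge v 0 (x j)) ->
       vge v N ((g (\row_j x j) : K) - meval x (h N))).
Proof.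
move=> [a [atail alim]].
pose s N : set (multinom n) := [set m | ~~ vge v (N : nat) (a m : K)].
have sfin N : finite_set (s N).
  have := atail [set y : valued v | vge v N y].
  have nU : nbhs (0 : valued v) [set y : valued v | vge v N y].
    by apply/(nbhs_valued vP); exists N => y; rewrite subr0.
  by move=> /(_ nU); apply: sub_finite_set => m /= /negP.
pose h N : mpoly n K := \sum_(m <- (fset_set (s N) : seq _)) (a m : K) *: mpolyX K m.
have hE N m : mcoeff m (h N) = if vge v N (a m : K) then 0 else (a m : K).
  rewrite /h raddf_sum /=; have memF : (m \in (fset_set (s N) : seq _)) = ~~ vge v N (a m : K).
    rewrite -[LHS]/(m \in fset_set (s N)) (in_fset_set (sfin N)).
    by apply/idP/idP => [/set_mem|h1]; last exact: mem_set.
  case: ifP => hm.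
    rewrite big_seq big1 // => m' hm'; rewrite mcoeffZ mcoeffX.
    case: eqP => [e|_]; last by rewrite mulr0.
    by move: hm'; rewrite e memF hm.
  rewrite (bigD1_seq m) ?memF ?hm ?fset_uniq //= mcoeffZ mcoeffX eqxx mulr1.
  by rewrite big1 ?addr0 // => m' mm'; rewrite mcoeffZ mcoeffX (negbTE mm') mulr0.
exists h; split.
  move=> N M NM m; rewrite mcoeffB !hE; case: ifP => h1; case: ifP => h2;
    rewrite ?subrr ?subr0 ?sub0r ?vge0 ?vgeN //.
  by move: h2; rewrite (vge_le _ h1) // lez_nat.
move=> N x x0; have xball : int_ball v n (\row_j (x j : valued v)).
  by move=> i; rewrite mxE; exact: x0.
have /alim /(_ [set y : valued v | vge v N (y - (g (\row_j x j) : K))]) := xball.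
case; first by apply/(nbhs_valued vP); exists N.
move=> B0 _ hB0.
(* from this total degree on, the partial sums contain all the terms kept in h N *)
pose B := maxn B0 (\max_(m <- (fset_set (s N) : seq _)) mdeg m).+1.
have := hB0 B (leq_maxl _ _); rewrite /= vge_subC // => hB.
apply: (vge_trans vP hB).
pose F (m : multinom n) : K := a m * mmap1 x m.
have -> : meval x (h N) = \sum_(m <- (fset_set (s N) : seq _)) F m.
  by rewrite /h raddf_sum; apply: eq_bigr => m _; rewrite /= mevalZ mevalX.
have -> : \sum_(m : bmultinom n B)
      (a m : K) * mmap1 (fun j => (\row_j (x j : valued v)) 0 j : K) m =
   \sum_(m : bmultinom n B) F m.
  by apply: eq_bigr => m _; rewrite /F; congr (_ * mmap1 _ _); apply/funext => j; rewrite mxE.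
rewrite (bigID (fun m : bmultinom n B => vge v N (a m : K))) /=.
have -> : \sum_(m <- (fset_set (s N) : seq _)) F m =
    \sum_(m : bmultinom n B | ~~ vge v N (a m : K)) F m.
  rewrite -[RHS]big_filter -[RHS](big_map (@bmnm n B) xpredT F).
  apply: perm_big; apply: uniq_perm; first exact: fset_uniq.
    rewrite map_inj_uniq; last exact: val_inj.
    by apply: filter_uniq; exact: index_enum_uniq.
  move=> m; rewrite -[LHS]/(m \in fset_set (s N)).
  rewrite (in_fset_set (sfin N)); apply/idP/mapP.
    move=> mS; have mB : (mdeg m < B)%N.
      rewrite leq_max ltnS; apply/orP; right.
      apply: leq_bigmax_seq => //.
      by rewrite -[_ \in _]/(m \in fset_set (s N)) (in_fset_set (sfin N)).
    exists (BMultinom mB) => //; rewrite mem_filter mem_index_enum andbT /=.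
    exact: set_mem mS.
  by move=> [m']; rewrite mem_filter => /andP[h1 _] ->; apply: mem_set.
rewrite addrK; apply: vge_sum => // m hm; apply: vgeM0 => //.
rewrite /mmap1; elim/big_ind: _ => [|y z hy hz|i _].
- by apply: veq_vge; rewrite veq1.
- exact: vge0M.
- exact: vge0X.
Qed.

(** Moving a point of the open set along the i-th axis changes <u, .> if u_i is
    nonzero. *)
Lemma analytic_dominant_nonconst (w : K) (w1 : veq v 1 w)
    (f : 'rV[valued v]_n -> 'rV[valued v]_r)
    (u : 'rV[K]_r) (c : K) :
  analytic_dominant f -> u != 0 ->
  exists2 x, int_ball v n x & inner u (f x : 'rV[K]_r) != c.
Proof.
move=> [U [Uo [y0 Uy0]] Uf] /rV0Pn[i ui].
have /(nbhs_rV vP)[k hk] : nbhs y0 U by exact: open_nbhs_nbhs.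
apply: contrapT => hN.
have const y : U y -> inner u (y : 'rV[K]_r) = c.
  move=> /Uf[x xR <-]; apply: contrapT => /eqP h; apply: hN; by exists x.
pose y1 : 'rV[valued v]_r := y0 + (w ^+ k : valued v) *: delta_mx 0 i.
have Uy1 : U y1.
  apply: hk => j; rewrite /y1 !mxE eqxx /= addrAC subrr add0r.
  case: (j == i); rewrite ?mulr1 ?mulr0 ?vge0 //.
  by have := veqX vP k w1 => /veq_vge; rewrite mul1r.
have := const _ Uy1; rewrite -(const _ Uy0) /inner => /eqP; rewrite -subr_eq0 -sumrB.
rewrite (bigD1 i) //= big1 => [|j ji].
  rewrite addr0 !mxE !eqxx /= mulr1 mulrDr addrAC subrr add0r mulf_eq0 (negbTE ui) /=.
  by rewrite expf_eq0 (negbTE (veq_neq0 vP w1)) andbF.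
by rewrite !mxE eqxx (negbTE ji) /= mulr0 addr0 subrr.
Qed.

End AnalyticMaps.

(** * Integrals of locally constant functions *)

Section HaarIntegral.
Variables (K : fieldType) (v : K -> \bar int).
Hypothesis vP : valuation v.
Variables (R : realType) (n : nat).
Variable mu : {measure set (borel v n) -> \bar R}.
Hypothesis muP : haar_measure mu.

Definition ball_rV (N : nat) (x : 'rV[valued v]_n) : set 'rV[valued v]_n :=
  [set y | forall i, vge v N (y 0 i - x 0 i)].

Lemma ball_rV_center N x : ball_rV N x x.
Proof. by move=> i; rewrite subrr vge0. Qed.

Lemma ball_rV_le N M x : (N <= M)%N -> ball_rV M x `<=` ball_rV N x.
Proof. by move=> NM y h i; apply: vge_le (h i); rewrite lez_nat. Qed.

Lemma ball_rV_eq N x y : ball_rV N x y -> ball_rV N x = ball_rV N y.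
Proof.
move=> xy; apply/seteqP; split=> z hz i.
  by apply: (vge_trans vP (hz i)); rewrite vge_subC.
exact: (vge_trans vP (hz i) (xy i)).
Qed.

Lemma open_rVP (A : set 'rV[valued v]_n) :
  open A <-> forall x, A x -> exists N, ball_rV N x `<=` A.
Proof.
rewrite openE; split=> Ao x Ax.
  have nA : nbhs x A by exact: Ao.
  by have [N hN] := (nbhs_rV vP x A).1 nA; exists N.
by apply/(nbhs_rV vP); have [N hN] := Ao x Ax; exists N.
Qed.

Lemma open_ball_rV N x : open (ball_rV N x).
Proof. by apply/open_rVP => y /ball_rV_eq ->; exists N. Qed.

Lemma open_measurable_borel (A : set 'rV[valued v]_n) :
  open A -> measurable (A : set (borel v n)).
Proof. exact: sub_sigma_algebra. Qed.

Lemma measurable_ball_rV N x : measurable (ball_rV N x : set (borel v n)).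
Proof. apply: open_measurable_borel; exact: open_ball_rV. Qed.

(** A ball of radius at most 1 is a translate of a subset of the unit ball. *)
Lemma mu_ball_le1 N x : (mu (ball_rV N x) <= 1)%E.
Proof.
have -> : ball_rV N x = [set x + y | y in ball_rV N 0].
  apply/seteqP; split=> y.
    move=> hy; exists (y - x); last by rewrite addrC subrK.
    by move=> i; rewrite !mxE subr0; exact: hy.
  by move=> [z hz <-] i; have := hz i; rewrite !mxE subr0 addrAC subrr add0r.
rewrite (haar_measure_translation muP); last exact: measurable_ball_rV.
rewrite -(haar_measure_int_ball muP).
have int_ballE : int_ball v n = ball_rV 0 0.
  by apply/seteqP; split=> y hy i; have := hy i; rewrite /val_ring /= mxE subr0.
rewrite int_ballE; apply: (le_measure mu); [apply: mem_set; exact: measurable_ball_rV..|].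
exact: ball_rV_le.
Qed.

Definition loc_const (T : Type) (A : set 'rV[valued v]_n) (G : 'rV[valued v]_n -> T) :=
  forall x, A x -> exists N, forall y, ball_rV N x y -> A y -> G y = G x.

Lemma loc_const_sub T (A B : set 'rV[valued v]_n) (G : 'rV[valued v]_n -> T) :
  B `<=` A -> loc_const A G -> loc_const B G.
Proof. by move=> BA GA x /BA/GA[N hN]; exists N => y xy /BA; exact: hN. Qed.

Lemma loc_const_comp T T' A (G : _ -> T) (g : T -> T') :
  loc_const A G -> loc_const A (g \o G).
Proof. by move=> h x /h[N hN]; exists N => y xy Ay; rewrite /= (hN y). Qed.

Lemma measurable_loc_const (A : set 'rV[valued v]_n) (G : 'rV[valued v]_n -> R) :
  open A -> loc_const A G -> measurable_fun (A : set (borel v n)) (G : borel v n -> R).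
Proof.
move=> /open_rVP Ao Ac mA Y mY; apply: open_measurable_borel; apply/open_rVP => x [Ax Yx].
have [N hN] := Ao x Ax; have [M hM] := Ac x Ax.
exists (maxn N M) => y xy.
have Ay : A y by apply: hN; exact: ball_rV_le (leq_maxl _ _) _ xy.
by split=> //=; rewrite hM //; exact: ball_rV_le (leq_maxr _ _) _ xy.
Qed.

Lemma integrable_loc_const (A : set 'rV[valued v]_n) (G : 'rV[valued v]_n -> R) M :
  open A -> (mu A < +oo)%E -> loc_const A G -> (forall x, A x -> `|G x| <= M) ->
  mu.-integrable A (EFin \o G).
Proof.
move=> Ao Afin Ac GM; apply: measurable_bounded_integrable => //.
- exact: open_measurable_borel.
- exact: measurable_loc_const.
exists M; split; first exact: num_real.
by move=> y My x Ax /=; apply: le_trans (ltW My); exact: GM.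
Qed.

Lemma translate_preimage (w : 'rV[valued v]_n) (A : set 'rV[valued v]_n) :
  (fun y => y + w) @^-1` A = [set - w + y | y in A].
Proof.
apply/seteqP; split=> [y Ay|_ [y Ay <-]] /=; last by rewrite addrAC addNr add0r.
by exists (y + w) => //; rewrite addrC addrK.
Qed.

Lemma measurable_translate (w : 'rV[valued v]_n) :
  measurable_fun setT ((fun y => y + w) : borel v n -> borel v n).
Proof.
apply: (@measurability _ _ (borel v n) (borel v n) setT _ (@open 'rV[valued v]_n)) => //.
move=> _ [B Bo <-]; rewrite setTI; apply: open_measurable_borel.
apply/open_rVP => x /= /(open_rVP B).1[|N hN] //; exists N => y xy /=; apply: hN => i.
by rewrite !mxE opprD addrACA subrr addr0; exact: xy.
Qed.

(** Translation by an element of the ball 0 + pi^N R^n preserves each ball of the same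
    radius and the measure. *)
Lemma Rintegral_translate N x w (G : 'rV[valued v]_n -> R) M :
  ball_rV N 0 w -> loc_const (ball_rV N x) G ->
  (forall y, ball_rV N x y -> `|G y| <= M) ->
  Rintegral mu (ball_rV N x) (fun y => G (y + w)) = Rintegral mu (ball_rV N x) G.
Proof.
move=> wN Gc GM.
have mB := @measurable_ball_rV N x; have oB : open (ball_rV N x) by exact: open_ball_rV.
have preB : (fun y => y + w) @^-1` ball_rV N x = ball_rV N x.
  have wi i : vge v N (w 0 i : K) by have := wN i; rewrite mxE subr0.
  apply/seteqP; split=> y hy i; have := hy i; rewrite /= !mxE.
    by move=> h; rewrite -[y 0 i](addrK (w 0 i)) addrAC; apply: vgeB.
  by move=> h; rewrite addrAC; apply: vgeD.
(* G is extended by 0 outside the ball, as it is only known to be measurable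
   there *)
pose g : borel v n -> \bar R := (EFin \o G) \_ (ball_rV N x).
have mg : measurable_fun [set: borel v n] g.
  apply/(measurable_restrictT _ mB); apply/measurable_EFinP.
  exact: measurable_loc_const.
have gE y : ball_rV N x y -> g y = (G y)%:E.
  by move=> hy; rewrite /g /patch mem_set.
have inB y : ball_rV N x y -> ball_rV N x (y + w) by move=> hy; rewrite -[X in X y]preB in hy.
pose tau : borel v n -> borel v n := fun y => y + w.
rewrite /Rintegral; congr fine.
transitivity (\int[mu]_(y in ball_rV N x) (g \o tau) y)%E.
  by apply: eq_integral => y /set_mem hy; rewrite /= gE //; exact: inB.
rewrite -{1}preB.
rewrite -(@integral_pushforward _ _ (borel v n) (borel v n) R tau
  (measurable_translate w) mu _ g mg) //.
  transitivity (\int[mu]_(y in ball_rV N x) g y)%E; last first.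
    by apply: eq_integral => y /set_mem hy; rewrite gE.
  apply: eq_measure_integral; first exact: measurable_translate.
  move=> _ A mA _ /=.
  rewrite /pushforward; have := haar_measure_translation muP (- w) mA.
  by rewrite -translate_preimage.
rewrite preB.
apply: (@eq_integrable _ _ _ mu _ mB (EFin \o (fun y => G (y + w)))).
  by move=> y /set_mem hy; rewrite /= gE //; exact: inB.
apply: (@integrable_loc_const _ _ M) => //.
- exact: le_lt_trans (mu_ball_le1 _ _) (ltry _).
- move=> y hy; have [k hk] := Gc _ (inB _ hy); exists k => z yz hz; apply: hk; last exact: inB.
  by move=> i; rewrite !mxE opprD addrACA subrr addr0; exact: yz.
by move=> y hy; apply: GM; exact: inB.
Qed.

(** Averaging over translations: the integral of G is also the integral of the mean of the
    translates of G by the elements of ws, and the ball has measure at most 1. *)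
Lemma Rintegral_ball_average N x (G : 'rV[valued v]_n -> R) M c (ws : seq 'rV[valued v]_n) :
  (forall w, w \in ws -> ball_rV N 0 w) ->
  loc_const (ball_rV N x) G ->
  (forall y, ball_rV N x y -> `|G y| <= M) ->
  0 <= c ->
  (forall y, ball_rV N x y -> `|\sum_(w <- ws) G (y + w)| <= c) ->
  (size ws)%:R * `|Rintegral mu (ball_rV N x) G| <= c.
Proof.
move=> wsN Gc GM c0 Gle; set B := ball_rV N x.
have mB : measurable (B : set (borel v n)) by exact: measurable_ball_rV.
have oB : open B by exact: open_ball_rV.
have finB : (mu B < +oo)%E by exact: le_lt_trans (mu_ball_le1 _ _) (ltry _).
have inB w y : ball_rV N 0 w -> B y -> B (y + w).
  move=> hw hy i; rewrite mxE addrAC; apply: (vgeD vP); first exact: hy.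
  by have := hw i; rewrite mxE subr0.
have lcw w : ball_rV N 0 w -> loc_const B (fun y => G (y + w)).
  move=> hw y hy; have [k hk] := Gc _ (inB _ _ hw hy); exists k => z yz hz.
  apply: hk; last exact: inB.
  by move=> i; rewrite !mxE opprD addrACA subrr addr0; exact: yz.
have intw w : ball_rV N 0 w -> mu.-integrable B (EFin \o (fun y => G (y + w))).
  move=> hw; apply: (@integrable_loc_const _ _ M) => //; first exact: lcw.
  by move=> y hy; apply: GM; exact: inB.
have [sumE sumI] : Rintegral mu B (fun y => \sum_(w <- ws) G (y + w)) =
    (size ws)%:R * Rintegral mu B G /\
    mu.-integrable B (EFin \o (fun y => \sum_(w <- ws) G (y + w))).
  elim: ws wsN {Gle} => [|w ws IH] wsN.
    have -> : (fun y => \sum_(w <- [::]) G (y + w)) = (fun=> 0).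
      by apply/funext => y; rewrite big_nil.
    by rewrite mul0r; split; [rewrite Rintegral_cst // mul0r|exact: integrable0].
  have [|IH1 IH2] := IH; first by move=> w' hw'; apply: wsN; rewrite inE hw' orbT.
  have wN : ball_rV N 0 w by apply: wsN; rewrite mem_head.
  have -> : (fun y => \sum_(w' <- w :: ws) G (y + w')) =
      (fun y => G (y + w) + \sum_(w' <- ws) G (y + w')).
    by apply/funext => y; rewrite big_cons.
  split; last by have := integrableD mB (intw _ wN) IH2.
  rewrite RintegralD // ?IH1; [|exact: intw].
  by rewrite (Rintegral_translate wN Gc GM) mulrS mulrDl mul1r.
have absI : mu.-integrable B (EFin \o (fun y => `|\sum_(w <- ws) G (y + w)|)).
  exact: integrable_norm.
rewrite -[X in X * _]ger0_norm ?ler0n // -normrM -sumE.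
apply: le_trans (le_normr_Rintegral _ _) _ => //.
apply: (@le_trans _ _ (Rintegral mu B (fun=> c))).
  apply: le_Rintegral => //.
  by apply: (@integrable_loc_const _ _ c) => // [y _|y _]; [exists 0%N|rewrite ger0_norm].
rewrite Rintegral_cst // ler_piMr //.
by rewrite -lee_fin fineK ?mu_ball_le1 // ge0_fin_numE.
Qed.

Lemma Rintegral_ball_le1 N x (G : 'rV[valued v]_n -> R) :
  loc_const (ball_rV N x) G -> (forall y, ball_rV N x y -> `|G y| <= 1) ->
  `|Rintegral mu (ball_rV N x) G| <= 1.
Proof.
move=> Gc G1; have := Rintegral_ball_average (ws := [:: 0]) _ Gc G1 ler01.
rewrite mul1r; apply=> [w'|y xy]; first by rewrite inE => /eqP ->; exact: ball_rV_center.
by rewrite big_seq1 addr0; exact: G1.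
Qed.

(** Two balls of the same radius are equal or disjoint, so a list of balls covering the
    support can be thinned out to a partition. *)
Lemma Rintegral_ball_cover (D : set 'rV[valued v]_n) (G : 'rV[valued v]_n -> R) N M b
    (cs : seq 'rV[valued v]_n) :
  loc_const D G -> (forall x, D x -> `|G x| <= M) ->
  (forall x, D x -> G x != 0 -> exists2 c, c \in cs & ball_rV N c x) ->
  (forall c, c \in cs -> ball_rV N c `<=` D) ->
  (forall c, c \in cs -> `|Rintegral mu (ball_rV N c) G| <= b) ->
  `|Rintegral mu D G| <= (size cs)%:R * b.
Proof.
move=> Gc GM Gsupp csD Gb.
pose A (s : seq 'rV[valued v]_n) : set 'rV[valued v]_n :=
  [set x | exists2 c, c \in s & ball_rV N c x].
have AD : A cs `<=` D by move=> x [c cc]; apply: csD.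
have -> : Rintegral mu D G = Rintegral mu (A cs) G.
  rewrite Rintegral_mkcond [RHS]Rintegral_mkcond; congr Rintegral; apply/funext => x.
  rewrite /patch; case: ifPn => [/set_mem xD|xD].
    case: ifPn => // xA; apply/eqP; apply: contraNT xA => /(Gsupp _ xD) h.
    exact: mem_set.
  case: ifPn => // /set_mem/AD xD'; by rewrite (mem_set xD') in xD.
have A_cons c s : A (c :: s) = ball_rV N c `|` A s.
  apply/seteqP; split=> x.
    by move=> [c']; rewrite inE => /orP[/eqP ->|]; [left|right; exists c'].
  move=> [h|[c' h1 h2]]; first by exists c; rewrite ?mem_head.
  by exists c' => //; rewrite inE h1 orbT.
have Ao s : open (A s).
  by apply/open_rVP => x [c cc cx]; exists N; rewrite -(ball_rV_eq cx) => y; exists c.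
have Afin s : (mu (A s) < +oo)%E.
  elim: s => [|c s IH].
    have -> : A [::] = set0 by apply/seteqP; split=> x // [].
    by rewrite measure0.
  have mAs : measurable (A s : set (borel v n)) by apply: open_measurable_borel; exact: Ao.
  rewrite A_cons; apply: (le_lt_trans (measureU2 mu (@measurable_ball_rV N c) mAs)).
  apply: lte_add_pinfty; last exact: IH.
  exact: le_lt_trans (mu_ball_le1 _ _) (ltry _).
elim: cs {Gsupp} csD Gb AD => [|c s IH] csD Gb AD.
  have -> : A [::] = set0 by apply/seteqP; split=> x // [].
  by rewrite Rintegral_set0 normr0 mul0r.
have {}IH : `|Rintegral mu (A s) G| <= (size s)%:R * b.
  apply: IH => [c' cs|c' cs|x [c' cs]].
  - by apply: csD; rewrite inE cs orbT.
  - by apply: Gb; rewrite inE cs orbT.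
  by apply: csD; rewrite inE cs orbT.
have b0 : 0 <= b by apply: le_trans (Gb c (mem_head _ _)).
have [[x [cx [c' c's c'x]]]|disj] := pselect (exists x, ball_rV N c x /\ A s x).
  have -> : A (c :: s) = A s.
    rewrite A_cons; apply/setUidPr => y cy; exists c' => //.
    by rewrite (ball_rV_eq c'x) -(ball_rV_eq cx).
  by apply: le_trans IH _; rewrite ler_wpM2r // ler_nat.
rewrite A_cons Rintegral_setU.
- apply: le_trans (ler_normD _ _) _; rewrite /= mulrS mulrDl mul1r.
  by apply: lerD => //; apply: Gb; rewrite mem_head.
- exact: measurable_ball_rV.
- by apply: open_measurable_borel; exact: Ao.
- rewrite -A_cons; apply: (@integrable_loc_const _ _ M) => //.
    exact: loc_const_sub Gc.
  by move=> x /AD; apply: GM.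
by apply/disj_setPS => x [h1 h2]; apply: disj; exists x.
Qed.

End HaarIntegral.

(** * Decay on small balls *)

(** Bookkeeping for the exponents: a gain of r0 on a ball of radius q^-N amounts to a
    gain of about L / N. *)
Lemma exponent_budget (L S E k r0 N : nat) :
  (L <= 2 * (S + (N + E) * k) + 2 * (k * r0) + 2 * k)%N ->
  (2 * S + 2 * E * k + 2 * k + 1 <= N)%N -> (L <= N * (r0 + N))%N.
Proof.
move=> LS hN; apply: (leq_trans LS).
have h1 : (2 * k * r0 <= N * r0)%N by rewrite leq_mul2r; apply/orP; right; lia.
have h2 : ((2 * k + 1) * N <= N * N)%N by rewrite leq_mul2r; apply/orP; right; lia.
by rewrite mulnDr; lia.
Qed.

(** All that is used of the standard character of K. Its values are only bounded
    through their real and imaginary parts, which are integrated separately. *)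
Record unitary_char (R : realType) (K : fieldType) (v : K -> \bar int)
    (psi : K -> R[i]) : Prop := UnitaryChar {
  unitary_charD : forall x y, psi (x + y) = psi x * psi y;
  unitary_char_Re : forall x, `|complex.Re (psi x)| <= 1;
  unitary_char_Im : forall x, `|complex.Im (psi x)| <= 1;
  unitary_char_conductor : exists d : nat, forall x, vge v d x -> psi x = 1;
  unitary_char_neq1 : exists z, psi z != 1 }.

(** Where f is studied: for a polynomial map, a large ball containing the support of
    phi; for an analytic map, the unit ball, that is E = 0. *)
Definition big_ball (K : fieldType) (v : K -> \bar int) (n E : nat) :
  set 'rV[valued v]_n := [set x : 'rV[valued v]_n | forall j, vge v (- E%:Z) (x 0 j : K)].
Arguments big_ball {K} v n E.

(** The form in which polynomial and analytic maps enter the estimates, after rescaling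
    to the unit ball. A Cauchy condition on Gauss norms, not only on values, is what
    keeps the coefficients along lines under control. *)
Record poly_approx (K : fieldType) (v : K -> \bar int) (w : K) (n r E : nat)
    (f : 'rV[valued v]_n -> 'rV[valued v]_r) (h : 'I_r -> nat -> mpoly n K) : Prop :=
  PolyApprox {
  poly_approx_cauchy : forall i (N M : nat), (N <= M)%N -> mgauss_ge v N (h i M - h i N);
  poly_approx_lim : forall i (N : nat) (x : 'I_n -> K), (forall j, vge v 0 (x j)) ->
    vge v N ((f (\row_j (w ^- E * x j : valued v)) 0 i : K) - meval x (h i N)) }.

Section LocalDecay.
Variables (K : fieldType) (v : K -> \bar int).
Hypothesis vP : valuation v.

Lemma meval_lipschitz M s n (h : mpoly n K) (x x' : 'I_n -> K) :
  (forall j, vge v 0 (x j)) -> (forall j, vge v 0 (x' j)) ->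
  (forall j, vge v s (x j - x' j)) -> mgauss_ge v M h ->
  vge v (M + s) (meval x h - meval x' h).
Proof.
move=> x0 x'0 xx' hM.
have at0 z : (line_poly h z (fun=> 0)).[0] = meval z h.
  by rewrite horner_line_poly; congr meval; apply/funext => j; rewrite mul0r addr0.
have := gauss_line_poly_sub vP x0 x'0 (fun=> vge0 vP 0) xx' hM.
by move=> /(vge_horner vP)/(_ (vge0 vP 0)); rewrite hornerD hornerN !at0.
Qed.

Lemma ball_rV_big_ball n E N (x : 'rV[valued v]_n) :
  big_ball v n E x -> ball_rV N x `<=` big_ball v n E.
Proof.
move=> Dx y xy j; rewrite -(subrK (x 0 j) (y 0 j)); apply: (vgeD vP); last exact: Dx.
by apply: vge_le (xy j); lia.
Qed.

Variables (w : K) (n r E0 : nat).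
Hypothesis w1 : veq v 1 w.
Variable f : 'rV[valued v]_n -> 'rV[valued v]_r.
Variable h : 'I_r -> nat -> mpoly n K.
Hypothesis fh : poly_approx w E0 f h.
Let D := big_ball v n E0.
Let unscale (x : 'I_n -> K) : 'rV[valued v]_n := \row_j (w ^- E0 * x j : valued v).
Let scale (x : 'rV[valued v]_n) : 'I_n -> K := fun j => w ^+ E0 * x 0 j.
Let F (i : 'I_r) (x : 'I_n -> K) : K := f (unscale x) 0 i.
Let h_cauchy := poly_approx_cauchy fh.
Let h_lim : forall i (N : nat) x, (forall j, vge v 0 (x j)) ->
  vge v N (F i x - meval x (h i N)) := poly_approx_lim fh.

Let wE0 : w ^+ E0 != 0. Proof. by rewrite expf_neq0 // (veq_neq0 vP w1). Qed.

Let visw (k : nat) : veq v k (w ^+ k). Proof. by have := veqX vP k w1; rewrite mul1r. Qed.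

Let scaleK x : unscale (scale x) = x.
Proof. by apply/rowP => j; rewrite !mxE /scale mulKf. Qed.

Let scale_int x : D x -> forall j, vge v 0 (scale x j).
Proof.
move=> Dx j; rewrite /scale (vge_mulr_veq vP _ _ (visw E0)) sub0r; exact: Dx.
Qed.

Lemma map_uniform_continuous (M : nat) : exists N : nat,
  forall x x', D x -> ball_rV N x x' -> forall i, vge v M ((f x' 0 i : K) - f x 0 i).
Proof.
have /choice[c hc] : forall i, exists c, mgauss_ge v c (h i M) by move=> i; exact: mgauss_ex.
exists (M + \max_i `|c i|)%N => x x' Dx xx' i.
have Dx' := ball_rV_big_ball Dx xx'.
have h1 := h_lim i M (scale_int Dx); have h2 := h_lim i M (scale_int Dx').
rewrite /F !scaleK in h1 h2.
have h3 : vge v (c i + (M%:Z + `|c i|)) (meval (scale x') (h i M) - meval (scale x) (h i M)).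
  apply: meval_lipschitz => //; [exact: scale_int..|] => j.
  rewrite /scale -mulrBr; apply: vge0M => //; first by apply: vge_le (veq_vge (visw E0)).
  by apply: vge_le (xx' j); have := leq_bigmax (F := fun i => `|c i|%N) i; lia.
have -> : (f x' 0 i : K) - f x 0 i = (f x' 0 i - meval (scale x') (h i M)) -
  (f x 0 i - meval (scale x) (h i M)) + (meval (scale x') (h i M) - meval (scale x) (h i M)).
  by ring.
by apply: vgeD => //; [apply: vgeB|apply: vge_le h3; lia].
Qed.

Variables (R : realType) (psi : K -> R[i]).
Hypothesis psiP : unitary_char v psi.

Lemma char_map_loc_const (y : 'rV[K]_r) : loc_const D (fun x => psi (inner y (f x : 'rV[K]_r))).
Proof.
have [d psid] := unitary_char_conductor psiP.
move=> x Dx; have [c hc] := vge_ex_fin (fun i => y 0 i) vP.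
have [N hN] := map_uniform_continuous (d + `|c|).
exists N => x' xx' _.
have -> : inner y (f x' : 'rV[K]_r) =
    (inner y (f x' : 'rV[K]_r) - inner y (f x : 'rV[K]_r)) + inner y (f x : 'rV[K]_r).
  by rewrite subrK.
rewrite (unitary_charD psiP) psid ?mul1r // /inner -sumrB; apply: vge_sum => // i _.
rewrite -mulrBr; apply: vge_le (vgeM vP (hc i) (hN _ _ Dx xx' i)); lia.
Qed.

Hypothesis char0 : forall k : nat, (0 < k)%N -> (k%:R : K) != 0.
Variable A : seq K.
Hypothesis AP : residue_system v A.
Let q := size A.
Variable mu : {measure set (borel v n) -> \bar R}.
Hypothesis muP : haar_measure mu.
Variable xi : R[i] -> R.
Hypothesis xiD : {morph xi : a b / a + b}.
Hypothesis xi1 : forall x, `|xi (psi x)| <= 1.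

(** The local estimate, with constants valid for all u near u0, all balls near x0 and all
    frequencies w^-L: the integral is at most N q^-r0, and L <= N (r0 + N)
    bounds r0 from below. Only the line through x0 and x1 is used, in the
    parameter w^(N + E0) t so that the translations stay in a ball of radius q^-N. *)
Lemma Rintegral_ball_decay (u0 : 'rV[K]_r) (x0 x1 : 'rV[valued v]_n) :
  D x0 -> D x1 -> (forall i, vge v 0 (u0 0 i)) ->
  inner u0 (f x1 : 'rV[K]_r) != inner u0 (f x0 : 'rV[K]_r) ->
  exists N0 : nat, forall (N : nat) (u : 'rV[K]_r) (x : 'rV[valued v]_n),
    (N0 <= N)%N -> (forall i, vge v 0 (u 0 i)) ->
    (forall i, vge v N0 (u 0 i - u0 0 i)) -> ball_rV N0 x0 x ->
    forall L : nat, exists2 r0 : nat, (L <= N * (r0 + N))%N &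
      (q ^ r0)%:R *
      `|Rintegral mu (ball_rV N x)
          (fun x => xi (psi (inner (w ^- L *: u) (f x : 'rV[K]_r))))| <= N%:R.
Proof.
have psiD := unitary_charD psiP.
have [d psid] := unitary_char_conductor psiP.
have [z0 psiz0] := unitary_char_neq1 psiP.
have [d' z0d'] : exists d', veq v d' z0.
  apply: (veq_exists vP); apply: contraNneq psiz0 => ->.
  by rewrite psid // vge0.
move=> Dx0 Dx1 u0int neq.
pose e j := scale x1 j - scale x0 j.
have eint j : vge v 0 (e j) by apply: vgeB => //; exact: scale_int.
have := line_approx vP h_cauchy h_lim u0int (scale_int Dx0) eint.
have -> : (fun j => scale x0 j + e j) = scale x1 by apply/funext => j; rewrite /e addrC subrK.
rewrite /F !scaleK => /(_ neq) [k [kappa [C [s [k0 approx]]]]].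
have [nu vnu] := veq_exists vP (char0 k0).
have nu0 : (0 <= nu)%R by rewrite -(vge_veq _ vnu) vge_nat.
pose S0 := (`|kappa| + `|nu| + C + d + `|d'|)%N.
(* large enough for the k-th coefficient to be stable, to dominate those of
   higher degree, and for the bookkeeping of [exponent_budget] *)
exists (s + 2 * S0 + 2 * E0 * k + 2 * k + 1)%N => N u x N0N uint uu0 xx0 L.
have Dx : D x by exact: ball_rV_big_ball xx0.
have ballD := @ball_rV_big_ball n E0 N x Dx.
(* x1 - x0 lies in the ball of radius q^E0: the shift by E0 makes w^N' (x1 - x0)
   an admissible translation *)
pose N' := (N + E0)%N.
pose S := (S0 + N' * k)%N.
pose G y := xi (psi (inner (w ^- L *: u) (f y : 'rV[K]_r))).
have G_lc : loc_const (ball_rV N x) G.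
  apply: (loc_const_sub ballD); apply: loc_const_comp; exact: char_map_loc_const.
have G1 y : ball_rV N x y -> `|G y| <= 1 by move=> _; exact: xi1.
(* for small L there is no gain: take r0 = 0 and the trivial bound *)
case: (ltnP L./2 S) => [LS|SL].
  exists 0%N.
    apply: (@exponent_budget L S0 E0 k 0 N); last by clear -N0N; lia.
    by clear -LS; rewrite -/N' -/S; lia.
  rewrite expn0 mul1r; apply: (@le_trans _ _ 1); first exact: Rintegral_ball_le1.
  by rewrite (ler_nat _ 1); clear -N0N; lia.
(* the largest r0 that the sublevel estimate allows *)
pose r0 := ((L./2 - S) %/ k)%N.
pose l := (uphalf L + C + d)%N.
have r0k : (k * r0 <= L./2 - S)%N by rewrite mulnC leq_trunc_div.
have r0k' : (L./2 - S < k * r0 + k)%N by have := ltn_ceil (L./2 - S) k0; rewrite mulSn mulnC addnC.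
have L2 : (L = L./2 + uphalf L)%N by rewrite uphalf_half addnCA addnn odd_double_half.
exists r0.
  apply: (@exponent_budget L S0 E0 k r0 N); last by clear -N0N; lia.
  by move: L2; rewrite uphalf_half -/N' -/S; clear -r0k'; lia.
have A_int := @digits_int _ _ vP _ _ w1 AP.
have Uw := visw N'.
pose shift t z := (w ^+ N' * (t + w ^+ l * z)) *: (x1 - x0).
pose ws : seq 'rV[valued v]_n := [seq shift t z | t <- digits w A r0, z <- digits w A l].
have q0 : (0 < q)%N.
  by have [a aA _] := residue_system_onto AP (vge0 vP 0); rewrite /q; case: (A) aA.
have tz_int t z : t \in digits w A r0 -> z \in digits w A l -> vge v 0 (t + w ^+ l * z).
  move=> ht hz; apply: vgeD => //; first exact: A_int ht.
  by apply: vge0M; rewrite ?(A_int _ _ hz) //; apply: vge_le (veq_vge (visw l)).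
have wsN w' : w' \in ws -> ball_rV N 0 w'.
  move=> /allpairsP[[t z] /= [ht hz ->]] j; rewrite /shift !mxE subr0 -mulrA.
  rewrite (vge_mulr_veq vP _ _ Uw); apply: vge0M => //; first exact: tz_int.
  by apply: vgeB => //; [apply: vge_le (Dx1 j)|apply: vge_le (Dx0 j)];
    rewrite /N' PoszD opprD addrA subrr sub0r.
have sum_le y : ball_rV N x y -> `|\sum_(w' <- ws) G (y + w')| <= k.-1%:R * (q ^ l)%:R.
  move=> xy; have Dy : D y by exact: ballD.
  have xx0y : ball_rV (s + 2 * S0 + 2 * E0 * k + 2 * k + 1) x0 y.
    by move=> i; exact: (vge_trans vP (ball_rV_le N0N xy i) (xx0 i)).
  have [||Ay [vk gAy Aapprox]] :=
      approx (fun i => u 0 i) (scale y) uint (scale_int Dy) _ _ (L + d)%N.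
  - by move=> i; apply: vge_le (uu0 i); rewrite lez_nat; clear; lia.
  - move=> j; rewrite /scale -mulrBr; apply: vge0M => //.
      by apply: vge_le (veq_vge (visw E0)).
    by apply: vge_le (xx0y j); rewrite lez_nat; clear; lia.
  (* w^-L Ay (w^N' T) *)
  pose B := \poly_(j < size Ay) (w ^- L * Ay`_j * w ^+ (N' * j)).
  have BE j : B`_j = w ^- L * Ay`_j * w ^+ (N' * j).
    rewrite coef_poly; case: ltnP => // hj; by rewrite (nth_default _ hj) mulr0 mul0r.
  have Bhorner T : B.[T] = w ^- L * Ay.[w ^+ N' * T].
    rewrite horner_poly horner_coef mulr_sumr; apply: eq_bigr => j _.
    by rewrite exprMn exprM; ring.
  have veqL : veq v (- L%:Z) (w ^- L) by apply: veqV.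
  have Bge j : vge v (- L%:Z - C%:Z + (N' * j)%N%:Z) B`_j.
    rewrite BE; apply: vgeM => //; last exact: veq_vge (visw _).
    by apply: vgeM => //; exact: veq_vge.
  have Bgauss : gauss_ge v (- L%:Z - C%:Z) B.
    by move=> j; apply: vge_le (Bge j); rewrite lerDl.
  have Bk : veq v (- L%:Z + kappa + (N' * k)%N%:Z) B`_k.
    by rewrite BE; apply: veqM => //; apply: veqM.
  have Bdom : dominant_coef v (- L%:Z + kappa + (N' * k)%N%:Z + nu) k.-1 B^`().
    split=> [|j kj]; rewrite coef_deriv -mulr_natr.
      by rewrite prednK //; apply: veqM.
    apply: vgeM0 => //; last exact: vge_nat.
    apply: vge_le (Bge j.+1).
    have : (N' * k + N' <= N' * j.+1)%N by rewrite -mulnSr leq_mul2l ltnS -(prednK k0) kj orbT.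
    by rewrite /N'; clear -N0N nu0; lia.
  have sumE : \sum_(w' <- ws) G (y + w') =
      \sum_(t <- digits w A r0) \sum_(z <- digits w A l) xi (psi B.[t + w ^+ l * z]).
    rewrite /ws big_allpairs_dep big_seq [RHS]big_seq; apply: eq_bigr => t ht.
    rewrite big_seq [RHS]big_seq; apply: eq_bigr => z hz.
    have tau_int : vge v 0 (w ^+ N' * (t + w ^+ l * z)).
      by apply: vge0M; rewrite ?tz_int //; apply: vge_le (veq_vge (visw N')).
    have := Aapprox _ tau_int; rewrite /F.
    have -> : unscale (fun j => scale y j + e j * (w ^+ N' * (t + w ^+ l * z))) = y + shift t z.
      apply/rowP => j; rewrite !mxE /shift /e /scale ?mxE.
      by field; exact: wE0.
    rewrite /G; move: (y + shift t z) => y' happ; congr (xi _).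
    have -> : inner (w ^- L *: u) (f y' : 'rV[K]_r) =
        w ^- L * (\sum_i u 0 i * f y' 0 i - Ay.[w ^+ N' * (t + w ^+ l * z)]) +
        B.[t + w ^+ l * z].
      rewrite Bhorner mulrBr subrK /inner mulr_sumr; apply: eq_bigr => i _.
      by rewrite mxE mulrA.
    rewrite psiD psid ?mul1r //.
    by rewrite (vge_mulr_veq vP _ _ veqL); apply: vge_le happ; clear; lia.
  rewrite sumE; apply: (line_sum_le vP w1 AP psiD psid z0d' psiz0 Bgauss _ _ xiD xi1 Bdom).
  - by rewrite /l; move: L2; rewrite uphalf_half; clear; lia.
  - by rewrite /l; move: L2; rewrite uphalf_half; clear; lia.
  have : (k.-1 * r0 + S <= L./2)%N.
    have : (k.-1 * r0 <= k * r0)%N by rewrite leq_mul2r leq_pred orbT.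
    by clear -r0k SL; lia.
  by rewrite /l /S /S0; clear -L2; lia.
have qr0 : 0 < (q ^ l)%:R :> R by rewrite ltr0n expn_gt0 q0.
have c0 : 0 <= k.-1%:R * (q ^ l)%:R :> R by rewrite mulr_ge0 // ler0n.
have := Rintegral_ball_average vP muP wsN G_lc G1 c0 sum_le.
rewrite size_allpairs !size_digits -/q natrM -mulrA [(q ^ l)%:R * _]mulrC mulrA.
rewrite ler_pM2r // => hle; apply: (le_trans hle); rewrite ler_nat; clear -N0N; lia.
Qed.

End LocalDecay.

(** * Compactness and the uniform estimate *)

Section Compactness.
Variables (K : fieldType) (v : K -> \bar int).
Hypothesis vP : valuation v.

Lemma compact_ball_cover n (S : set 'rV[valued v]_n) (N : nat) : compact S ->
  exists2 cs : seq 'rV[valued v]_n, (forall c, c \in cs -> S c) &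
    forall x, S x -> exists2 c, c \in cs & ball_rV N c x.
Proof.
rewrite compact_cover => /(_ _ S (@ball_rV K v n N)) [].
- by move=> c _; exact: open_ball_rV.
- by move=> x Sx; exists x => //; exact: ball_rV_center.
move=> X XS cover; exists (X : seq _); first by move=> c /XS /set_mem.
by move=> x /cover[c cX xc]; exists c.
Qed.

(** A property that holds near each point of S x U for all large N holds on all
    of S x U for some N; the constants in the local estimates are therefore
    stated as functions of N. *)
Lemma compact_uniform n r (S : set 'rV[valued v]_n) (U : set 'rV[valued v]_r)
    (P : nat -> 'rV[valued v]_n -> 'rV[valued v]_r -> Prop) :
  compact S -> compact U ->
  (forall x u, S x -> U u -> exists N0, forall N x' u', (N0 <= N)%N ->
     ball_rV N0 x x' -> ball_rV N0 u u' -> P N x' u') ->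
  exists2 N, (0 < N)%N & forall x u, S x -> U u -> P N x u.
Proof.
move=> Sc Uc loc.
have [|N0 _ hN0] := (compact_near_coveringP _).1 (compact_setX Sc Uc) nat \oo
    (fun N xu => P N xu.1 xu.2) _; last first.
  exists N0.+1 => // x u Sx Uu.
  by have := hN0 N0.+1 (leqnSn _) (x, u); apply.
move=> [x u] [/= Sx Uu]; have [N0 hN0] := loc x u Sx Uu.
exists ([set xu | ball_rV N0 x xu.1 /\ ball_rV N0 u xu.2], [set N | (N0 <= N)%N]) => /=.
  split; last by exists N0.
  exists (ball_rV N0 x, ball_rV N0 u); last by move=> [].
  by split; apply/(nbhs_rV vP); exists N0.
by move=> [[x' u'] N] [/= [hx hu] hN]; exact: hN0.
Qed.

Lemma compact_int_ball n : compact (val_ring v : set (valued v)) -> compact (int_ball v n).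
Proof. by move=> Rc; exact: (rV_compact (fun=> Rc)). Qed.

End Compactness.

Section VectorNorm.
Variables (R : realType) (K : fieldType) (v : K -> \bar int).
Hypothesis vP : valuation v.
Hypothesis q1 : (0 < residue_card v)%N.

Lemma vec_norm_val r (y : 'rV[valued v]_r) : y != 0 -> exists m : int,
  [/\ forall i, vge v m (y 0 i : K), exists i, veq v m (y 0 i : K) &
      vec_norm R y = (residue_card v)%:R ^ (- m)].
Proof.
move=> /rV0Pn[i1 yi1]; have [m1 vm1] := veq_exists vP yi1.
have [M0 hM0] := vge_ex_fin (fun i => y 0 i : K) vP.
pose P k := [forall i, vge v (M0 + k%:Z) (y 0 i : K)].
have P0 : exists k, P k by exists 0%N; apply/forallP => i; rewrite addr0; exact: hM0.
have Pbound k : P k -> (k <= `|(m1 - M0)%R|)%N.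
  by move=> /forallP/(_ i1); rewrite (vge_veq _ vm1); lia.
have [k /forallP Pk kmax] := ex_maxnP P0 Pbound.
exists (M0 + k%:Z).
have [i vi] : exists i, veq v (M0 + k%:Z) (y 0 i : K).
  have : ~~ P k.+1 by apply/negP => /kmax; rewrite ltnn.
  rewrite negb_forall => /existsP[i hi]; exists i; rewrite veqE // Pk /=.
  by apply: contra hi; apply: vge_le; lia.
split => //; first by exists i.
apply/eqP; rewrite eq_le; apply/andP; split.
  apply: bigmax_le => [|j _]; first by rewrite exprz_ge0 // ler0n.
  rewrite /vnorm; have := Pk j; rewrite /vge.
  case: (v (y 0 j)) => [l||] //; last by rewrite exprz_ge0 // ler0n.
  by rewrite lee_fin => h; rewrite ler_weXz2l ?ler1n //; lia.
apply: (bigmax_sup i) => //; rewrite /vnorm.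
by move: vi; rewrite /veq => /eqP ->.
Qed.

End VectorNorm.

Lemma normc_le (R : realType) (a b : R) : Normc.normc (Complex a b) <= `|a| + `|b|.
Proof.
rewrite /= -[leRHS]ger0_norm ?addr_ge0 // -sqrtr_sqr ler_sqrt ?sqr_ge0 //.
rewrite sqrrD !real_normK ?num_real // lerD2r lerDl mulrn_wge0 //.
Qed.

(** From the integral exponent r0 back to a real power of the norm q^L: raising to
    the power N turns the claim into q^L <= q^(N (r0 + N)). *)
Lemma invX_le_powR (R : realType) (q N L r0 : nat) :
  (0 < q)%N -> (0 < N)%N -> (L <= N * (r0 + N))%N ->
  ((q ^ r0)%:R^-1 : R) <= (q ^ N)%:R * ((q%:R : R) ^+ L) `^ (- (N%:R)^-1).
Proof.
move=> q0 N0 LN.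
have q1 : 1 <= q%:R :> R by rewrite ler1n.
have qL : 0 <= (q%:R : R) ^+ L by rewrite exprn_ge0 // ler0n.
have qrN : 0 <= (q%:R : R) ^+ (r0 + N) by rewrite exprn_ge0 // ler0n.
have NR : (N%:R : R) != 0 by rewrite pnatr_eq0 -lt0n.
have P0 : 0 < ((q%:R : R) ^+ L) `^ N%:R^-1 by rewrite powR_gt0 // exprn_gt0 // ltr0n.
rewrite powRN ler_pdivlMr // mulrC ler_pdivrMr ?ltr0n ?expn_gt0 ?q0 //.
rewrite -natrM -expnD natrX [(N + r0)%N]addnC.
apply: (@le_trans _ _ (((q%:R : R) ^+ (r0 + N) ^+ N) `^ N%:R^-1)).
  apply: ge0_ler_powR; rewrite ?invr_ge0 ?ler0n ?nnegrE ?exprn_ge0 ?ler0n //.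
  by rewrite -exprM ler_weXn2l // mulnC.
by rewrite -powR_mulrn // -powRrM mulfV // powRr1.
Qed.

Lemma ratr_complexE (R : realType) (a : rat) : (ratr a : R[i]) = Complex (ratr a) 0.
Proof. by rewrite -[RHS]/((ratr a)%:C%C) fmorph_rat. Qed.

Lemma Re_ratrM (R : realType) (a : rat) (z : R[i]) :
  complex.Re (ratr a * z) = ratr a * complex.Re z.
Proof. by rewrite ratr_complexE; case: z => x y /=; rewrite mul0r subr0. Qed.

Lemma Im_ratrM (R : realType) (a : rat) (z : R[i]) :
  complex.Im (ratr a * z) = ratr a * complex.Im z.
Proof. by rewrite ratr_complexE; case: z => x y /=; rewrite mul0r addr0. Qed.

Section Decay.
Variables (K : fieldType) (v : K -> \bar int).
Hypothesis vP : valuation v.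
Hypothesis char0 : forall k : nat, (0 < k)%N -> (k%:R : K) != 0.
Variables (w : K) (A : seq K).
Hypothesis w1 : veq v 1 w.
Hypothesis AP : residue_system v A.
Hypothesis A_card : size A = residue_card v.
Hypothesis intK_compact : compact (val_ring v : set (valued v)).
Variables (R : realType) (n r : nat).
Variable mu : {measure set (borel v n) -> \bar R}.
Hypothesis muP : haar_measure mu.
Variable psi : K -> R[i].
Hypothesis psiP : unitary_char v psi.
Variables (E0 : nat) (f : 'rV[valued v]_n -> 'rV[valued v]_r).
Variable h : 'I_r -> nat -> mpoly n K.
Hypothesis fh : poly_approx w E0 f h.
Let D := big_ball v n E0.
Hypothesis f_nonconst : forall (u : 'rV[K]_r) c, u != 0 ->
  exists2 x, D x & inner u (f x : 'rV[K]_r) != c.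

Variables (D' : set 'rV[valued v]_n) (phi : 'rV[valued v]_n -> rat).
Hypothesis DD' : D `<=` D'.
Hypothesis phiP : schwartz_bruhat D' phi.
Hypothesis phiD : D' `&` closure (D' `&` [set x | phi x != 0]) `<=` D.

Let suppD x : D' x -> phi x != 0 -> D x.
Proof.
by move=> D'x px; apply: phiD; split=> //; apply: subset_closure.
Qed.

Let phi_lc : loc_const D' phi.
Proof.
move=> x D'x; have := phiP.1 x D'x; rewrite /within => /(nbhs_rV vP)[N hN].
by exists N => y xy D'y; exact: hN.
Qed.

Let ball_D N x : D x -> ball_rV N x `<=` D := @ball_rV_big_ball _ _ vP n E0 N x.

(* Vacuous when u is not of norm 1; so u can range over the whole unit ball of K^r, a
   product of copies of the valuation ring and thus compact. *)
Let decay_at (xi : R[i] -> R) (N : nat) (x : 'rV[valued v]_n) (u : 'rV[valued v]_r) : Prop :=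
  (exists i, veq v 0 (u 0 i : K)) -> forall L : nat,
  exists2 r0 : nat, (L <= N * (r0 + N))%N &
    (residue_card v ^ r0)%:R * `|Rintegral mu (ball_rV N x)
       (fun x => xi (psi (inner (w ^- L *: (u : 'rV[K]_r)) (f x : 'rV[K]_r))))| <= N%:R.

Let uniform_decay : exists2 N, (0 < N)%N & forall x u,
  (D' `&` closure (D' `&` [set x | phi x != 0])) x -> int_ball v r u ->
  [/\ `|phi x| <= N%:R, forall x', ball_rV N x x' -> phi x' = phi x,
      decay_at (@complex.Re R) N x u & decay_at (@complex.Im R) N x u].
Proof.
have := @compact_uniform _ _ vP n r _ _
  (fun N x u => [/\ `|phi x| <= N%:R, forall x', ball_rV N x x' -> phi x' = phi x,
      decay_at (@complex.Re R) N x u & decay_at (@complex.Im R) N x u])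
  phiP.2 (compact_int_ball (n := r) intK_compact).
apply=> x0 u0 Sx0 u0int.
have Dx0 := phiD Sx0.
have [N1 hN1] := phi_lc (DD' Dx0).
have [N2 hN2] : exists N2 : nat, `|phi x0| <= N2%:R.
  by exists (Num.bound `|phi x0|); apply: ltW; apply: archi_boundP; exact: normr_ge0.
have [N3 hN3] : exists N3, forall N x u, (N3 <= N)%N -> int_ball v r u ->
    ball_rV N3 x0 x -> ball_rV N3 u0 u ->
    decay_at (@complex.Re R) N x u /\ decay_at (@complex.Im R) N x u.
  (* if u0 is not of norm 1, then nearby vectors are not either *)
  have [[i ui]|nounit] := pselect (exists i, veq v 0 (u0 0 i : K)); last first.
    exists 1%N; move=> N x u _ _ _ uu0.
    suff nu : ~ exists i, veq v 0 (u 0 i : K) by split=> h1; case: (nu h1).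
    move=> [j]; rewrite veqE // => /andP[u0j]; rewrite add0r => uj; apply: nounit; exists j.
    rewrite veqE // add0r; apply/andP; split; first exact: u0int.
    apply: contra uj => h1; rewrite -(subrK (u0 0 j : K) (u 0 j)).
    by apply: vgeD => //; exact: uu0.
  have u0n0 : (u0 : 'rV[K]_r) != 0.
    by apply/rV0Pn; exists i; exact: (veq_neq0 vP ui).
  have [x1 Dx1 neq] := f_nonconst (inner (u0 : 'rV[K]_r) (f x0 : 'rV[K]_r)) u0n0.
  have ReD : {morph (@complex.Re R) : a b / a + b} by move=> [a b] [a' b'].
  have ImD : {morph (@complex.Im R) : a b / a + b} by move=> [a b] [a' b'].
  have [NR hR] := Rintegral_ball_decay vP w1 fh psiP char0 AP muP
    ReD (unitary_char_Re psiP) Dx0 Dx1 u0int neq.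
  have [NI hI] := Rintegral_ball_decay vP w1 fh psiP char0 AP muP
    ImD (unitary_char_Im psiP) Dx0 Dx1 u0int neq.
  exists (maxn NR NI) => N x u hN uint xx0 uu0.
  split=> _; rewrite -A_card => L.
    apply: hR => //; first by apply: leq_trans hN; exact: leq_maxl.
      by move=> j; exact: (ball_rV_le (leq_maxl _ _) uu0 j).
    exact: (ball_rV_le (leq_maxl _ _) xx0).
  apply: hI => //; first by apply: leq_trans hN; exact: leq_maxr.
    by move=> j; exact: (ball_rV_le (leq_maxr _ _) uu0 j).
  exact: (ball_rV_le (leq_maxr _ _) xx0).
exists (maxn N1 (maxn N2 N3)) => N x u hN xx0 uu0.
have uint : int_ball v r u.
  move=> i; rewrite /val_ring /= -[X in v X](subrK (u0 0 i : K)) -/(vge v 0 _).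
  by apply: vgeD; [|apply: vge_le (uu0 i); lia|exact: u0int].
have xx0N1 : ball_rV N1 x0 x by exact: (ball_rV_le (leq_maxl _ _) xx0).
have [||||hR hI] := hN3 N x u.
- by apply: leq_trans hN; rewrite !leq_max leqnn !orbT.
- exact: uint.
- by apply: (ball_rV_le _ xx0); rewrite !leq_max leqnn !orbT.
- by apply: (ball_rV_le _ uu0); rewrite !leq_max leqnn !orbT.
have Dx : D x by exact: ball_D xx0.
split=> // [|x' xx'].
  rewrite (hN1 x) //; last exact: DD'.
  apply: (le_trans hN2); rewrite ler_nat; apply: leq_trans hN.
  by rewrite !leq_max leqnn orbT.
have NN1 : (N1 <= N)%N by apply: leq_trans hN; exact: leq_maxl.
rewrite (hN1 x) //; last exact: DD'.
apply: hN1; last by apply: DD'; exact: ball_D xx'.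
by move=> j; apply: (vge_trans vP (ball_rV_le NN1 xx' j)); exact: xx0N1.
Qed.

(* For fixed y the support is covered by finitely many balls of radius q^-N on
   which phi is constant. *)
Let component_le (xi : R[i] -> R) (N : nat) (cs : seq 'rV[valued v]_n) (y : 'rV[K]_r) (b : R) :
  (forall a z, xi (ratr a * z) = ratr a * xi z) -> (forall x, `|xi (psi x)| <= 1) ->
  (forall x, (D' `&` closure (D' `&` [set x | phi x != 0])) x -> `|phi x| <= N%:R) ->
  (forall c, c \in cs -> D c) ->
  (forall c x, c \in cs -> ball_rV N c x -> phi x = phi c) ->
  (forall x, (D' `&` closure (D' `&` [set x | phi x != 0])) x ->
     exists2 c, c \in cs & ball_rV N c x) ->
  (forall c, c \in cs -> `|phi c| <= N%:R) ->
  (forall c, c \in cs ->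
     `|Rintegral mu (ball_rV N c) (fun x => xi (psi (inner y (f x : 'rV[K]_r))))| <= b) ->
  `|Rintegral mu D' (fun x => xi (ratr (phi x) * psi (inner y (f x : 'rV[K]_r))))|
     <= (size cs)%:R * (N%:R * b).
Proof.
move=> xiZ xi1 phiN csD phic cover phicN bound.
have ratrN (a : rat) (M : nat) : `|a| <= M%:R -> `|ratr a : R| <= M%:R.
  by move=> aM; rewrite -ratr_norm -[leRHS](ratr_nat _ M) ler_rat.
have inS x : D' x -> phi x != 0 -> (D' `&` closure (D' `&` [set x | phi x != 0])) x.
  by move=> D'x px; split=> //; apply: subset_closure.
have psi_lc := char_map_loc_const vP w1 fh psiP y.
apply: (@Rintegral_ball_cover _ _ vP _ _ _ muP D' _ N N%:R) => //.
- move=> x D'x; have [N1 hN1] := phi_lc D'x.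
  have [px|px] := eqVneq (phi x) 0.
    exists N1 => z xz D'z; rewrite !xiZ (hN1 z xz D'z) px.
    by rewrite rmorph0 !mul0r.
  have Dx := suppD D'x px; have [N2 hN2] := psi_lc x Dx.
  exists (maxn N1 N2) => z xz D'z; rewrite (hN1 z) //.
    by rewrite hN2 //; [exact: (ball_rV_le (leq_maxr _ _) xz)|exact: ball_D xz].
  exact: (ball_rV_le (leq_maxl _ _) xz).
- move=> x D'x; rewrite xiZ normrM; have [px|px] := eqVneq (phi x) 0.
    by rewrite px rmorph0 normr0 mul0r ler0n.
  by rewrite -[leRHS]mulr1 ler_pM //; apply: ratrN; apply: phiN; exact: inS.
- move=> x D'x G0; apply: cover; apply: inS => //.
  by apply: contraNneq G0 => px; rewrite xiZ px rmorph0 mul0r.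
- by move=> c cc z cz; apply: DD'; apply: (ball_D (csD c cc)) cz.
move=> c cc; have Dc := csD c cc.
have -> : Rintegral mu (ball_rV N c) (fun x => xi (ratr (phi x) * psi (inner y (f x : 'rV[K]_r)))) =
   Rintegral mu (ball_rV N c) (fun x => ratr (phi c) * xi (psi (inner y (f x : 'rV[K]_r)))).
  by apply: eq_Rintegral => x /set_mem cx; rewrite xiZ (phic c x).
rewrite RintegralZl.
- by rewrite normrM ler_pM //; [apply: ratrN; exact: phicN|exact: bound].
- exact: measurable_ball_rV.
apply: (@integrable_loc_const _ _ vP _ _ _ _ _ 1) => //.
- exact: open_ball_rV.
- exact: le_lt_trans (mu_ball_le1 vP muP _ _) (ltry _).
- by apply: loc_const_comp; apply: loc_const_sub psi_lc; exact: ball_D.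
Qed.

(** The exponent is -1/N, with N the uniform radius provided by compactness; the
    constant also absorbs the trivial bound, which is all that is needed for y = 0 and
    for |y| <= 1. *)
Lemma exp_integral_decay : (0 < residue_card v)%N ->
  exists alpha c : R, [/\ alpha < 0, 0 < c &
    forall y : 'rV[valued v]_r,
      Normc.normc (Cintegral mu D' (fun x => ratr (phi x) * psi (inner y (f x : 'rV[K]_r))))
        < c * decay alpha y].
Proof.
move=> q0; have [N N0 unif] := uniform_decay.
have [cs csS cover] := @compact_ball_cover _ _ vP _ _ N phiP.2.
set S := _ `&` _ in unif csS cover.
have zint : int_ball v r 0 by move=> i; rewrite /val_ring /= mxE (valuation0 vP) leey.
have SN x : S x -> `|phi x| <= N%:R by move=> Sx; have [] := unif x 0 Sx zint.
have csD c : c \in cs -> D c by move=> /csS/phiD.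
have phic c x : c \in cs -> ball_rV N c x -> phi x = phi c.
  by move=> /csS Sc; have [_ h1 _ _] := unif c 0 Sc zint; exact: h1.
have phicN c : c \in cs -> `|phi c| <= N%:R by move=> /csS/SN.
pose T : R := (size cs)%:R * N%:R.
have T0 : 0 <= T by rewrite mulr_ge0 // ler0n.
have bound (y : 'rV[K]_r) b :
    (forall c, c \in cs ->
     `|Rintegral mu (ball_rV N c) (fun x => complex.Re (psi (inner y (f x : 'rV[K]_r))))| <= b) ->
    (forall c, c \in cs ->
     `|Rintegral mu (ball_rV N c) (fun x => complex.Im (psi (inner y (f x : 'rV[K]_r))))| <= b) ->
    Normc.normc (Cintegral mu D' (fun x => ratr (phi x) * psi (inner y (f x : 'rV[K]_r))))
      <= 2 * (T * b).
  move=> bR bI; apply: le_trans (normc_le _ _) _; rewrite mulr_natl mulr2n /T -mulrA.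
  apply: lerD; apply: component_le => //.
  - exact: Re_ratrM.
  - exact: (unitary_char_Re psiP).
  - exact: Im_ratrM.
  - exact: (unitary_char_Im psiP).
have trivial y : Normc.normc (Cintegral mu D'
    (fun x => ratr (phi x) * psi (inner y (f x : 'rV[K]_r)))) <= 2 * T.
  have lc c : c \in cs -> loc_const (ball_rV N c) (fun x => psi (inner y (f x : 'rV[K]_r))).
    by move=> cc; apply: loc_const_sub (char_map_loc_const vP w1 fh psiP y); exact: ball_D (csD c cc).
  rewrite -[T]mulr1; apply: bound => c cc.
    apply: (@Rintegral_ball_le1 _ _ vP _ _ _ muP).
      by apply: loc_const_comp; exact: lc.
    by move=> x _; exact: (unitary_char_Re psiP).
  apply: (@Rintegral_ball_le1 _ _ vP _ _ _ muP).
    by apply: loc_const_comp; exact: lc.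
  by move=> x _; exact: (unitary_char_Im psiP).
pose q := residue_card v.
pose C1 : R := 2 * (T * N%:R) * (q ^ N)%:R.
have C10 : 0 <= C1 by rewrite !mulr_ge0 // ler0n.
exists (- N%:R^-1), (C1 + 2 * T + 1); split.
- by rewrite oppr_lt0 invr_gt0 ltr0n.
- by rewrite ltr_wpDl // addr_ge0 // mulr_ge0.
move=> y; have triv1 : Normc.normc (Cintegral mu D'
    (fun x => ratr (phi x) * psi (inner y (f x : 'rV[K]_r)))) < C1 + 2 * T + 1.
  by apply: le_lt_trans (trivial y) _; rewrite ltr_pwDr // lerDr.
rewrite /decay; case: eqVneq => [_|y0]; first by rewrite mulr1.
have [m [my [i vi] ->]] := vec_norm_val R vP q0 y0.
rewrite minr_pMr; last by rewrite addr_ge0 // addr_ge0 // mulr_ge0.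
rewrite lt_min mulr1 triv1 andbT -/q.
have [m0|m0] := leP 0 m.
  apply: lt_le_trans triv1 _; rewrite ler_peMr //.
    by rewrite addr_ge0 // addr_ge0 // mulr_ge0.
  have a0 : 0 < (q%:R : R) ^ (- m) by rewrite exprz_gt0 // ltr0n.
  have one : (1 : R) `^ N%:R^-1 = 1 by rewrite powR1.
  rewrite powRN invf_ge1 ?powR_gt0 // -[leRHS]one.
  apply: ge0_ler_powR; rewrite ?invr_ge0 ?ler0n ?nnegrE ?ler01 ?(ltW a0) //.
  by rewrite -(expr0z (q%:R : R)) ler_weXz2l ?ler1n //; lia.
have [L LE] : exists L : nat, m = - L%:Z by exists `|m|%N; lia.
have qL0 : 0 < (q%:R : R) ^+ L by rewrite exprn_gt0 // ltr0n.
rewrite LE opprK; pose u : 'rV[K]_r := w ^+ L *: (y : 'rV[K]_r).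
have veqL : veq v L (w ^+ L) by have := veqX vP L w1; rewrite mul1r.
have wL0 := veq_neq0 vP veqL.
have yE : (y : 'rV[K]_r) = w ^- L *: u by rewrite /u scalerA mulVf // scale1r.
have uint : int_ball v r (u : 'rV[valued v]_r).
  by move=> j; rewrite /val_ring /= mxE -/(vge v 0 _) (vge_mulr_veq vP _ _ veqL) sub0r -LE.
have uunit : exists i, veq v 0 (u 0 i : K).
  by exists i; rewrite mxE -(addrN L%:Z) -LE; apply: veqM.
have hRI c : c \in cs ->
  `|Rintegral mu (ball_rV N c) (fun x => complex.Re (psi (inner (y : 'rV[K]_r) (f x : 'rV[K]_r))))|
     <= N%:R * ((q ^ N)%:R * ((q%:R : R) ^+ L) `^ (- N%:R^-1)) /\
  `|Rintegral mu (ball_rV N c) (fun x => complex.Im (psi (inner (y : 'rV[K]_r) (f x : 'rV[K]_r))))|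
     <= N%:R * ((q ^ N)%:R * ((q%:R : R) ^+ L) `^ (- N%:R^-1)).
  move=> /csS Sc; have [_ _ hR hI] := unif c u Sc uint.
  rewrite yE; split.
    have [r0 Lr0 hr0] := hR uunit L.
    apply: le_trans (ler_wpM2l (ler0n _ _) (invX_le_powR R q0 N0 Lr0)).
    by rewrite ler_pdivlMr ?ltr0n ?expn_gt0 ?q0 // mulrC.
  have [r0 Lr0 hr0] := hI uunit L.
  apply: le_trans (ler_wpM2l (ler0n _ _) (invX_le_powR R q0 N0 Lr0)).
  by rewrite ler_pdivlMr ?ltr0n ?expn_gt0 ?q0 // mulrC.
apply: le_lt_trans (bound y _ (fun c cc => (hRI c cc).1) (fun c cc => (hRI c cc).2)) _.
have -> (b : R) : 2 * (T * (N%:R * ((q ^ N)%:R * b))) = C1 * b by rewrite /C1 !mulrA.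
rewrite ltr_pM2r ?powR_gt0 //.
by rewrite -addrA ltrDl ltr_pwDr // mulr_ge0.
Qed.

End Decay.

(** * The theorem *)

Lemma compact_bounded (K : fieldType) (v : K -> \bar int) (vP : valuation v) n
    (S : set 'rV[valued v]_n) : compact S -> exists E : nat, S `<=` big_ball v n E.
Proof.
move=> /(compact_ball_cover vP 0)[cs _ cover].
have /choice[E hE] : forall c : 'rV[valued v]_n, exists E : nat, big_ball v n E c.
  move=> c; have [m hm] := vge_ex_fin (fun j => c 0 j : K) vP.
  by exists `|m|%N => j; apply: vge_le (hm j); lia.
exists (\max_(c <- cs) E c) => x /cover[c cc cx]; apply: (ball_rV_big_ball vP) cx.
by move=> j; apply: vge_le (hE c j); rewrite lerN2 lez_nat; apply: leq_bigmax_seq.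
Qed.

Section ExponentialSums.
Variables (p : nat) (Qp : fieldType) (vp : Qp -> \bar int).
Hypothesis p_prime : prime p.
Hypothesis QpP : padic_numbers p vp.
Variables (K : fieldExtType Qp) (v : K -> \bar int).
Hypothesis vP : padic_valuation vp v.
Let vV : valuation v := padic_valuation_valuation vP.

Lemma natr_ext_neq0 k : (0 < k)%N -> (k%:R : K) != 0.
Proof.
move=> k0; rewrite -scaler_nat scaler_eq0 oner_eq0 orbF.
exact: (natr_Qp_neq0 p_prime QpP).
Qed.

Lemma unitary_std_char (R : realType) : unitary_char v (@std_char R p Qp vp K).
Proof.
split; first exact: (std_charD p_prime QpP).
- by move=> x; exact: cos_max.
- by move=> x; exact: sin_max.
- have [d hd] := std_char_conductor p_prime QpP vP R.
  by exists `|d|%N => x xd; apply: hd; apply: vge_le xd; lia.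
exact: (std_char_neq1 p_prime QpP).
Qed.

(** The estimate for the standard character, common to the two cases of the theorem: f is
    only considered on a ball that contains the support of phi. *)
Lemma exp_integral_decay_ext (R : realType) (n r E : nat)
    (mu : {measure set (borel v n) -> \bar R}) (w : K)
    (f : 'rV[valued v]_n -> 'rV[valued v]_r) (h : 'I_r -> nat -> mpoly n K)
    (D : set 'rV[valued v]_n) (phi : 'rV[valued v]_n -> rat) :
  haar_measure mu -> veq v 1 w -> poly_approx w E f h ->
  (forall (u : 'rV[K]_r) c, u != 0 ->
    exists2 x, big_ball v n E x & inner u (f x : 'rV[K]_r) != c) ->
  big_ball v n E `<=` D -> schwartz_bruhat D phi ->
  D `&` closure (D `&` [set x | phi x != 0]) `<=` big_ball v n E ->
  exists alpha c : R, [/\ alpha < 0, 0 < c &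
    forall y : 'rV[valued v]_r,
      Normc.normc (exp_integral p vp mu D phi f y) < c * decay alpha y].
Proof.
move=> muP w1 fh fnc ED phiP phiE.
have [A A_card AP] := residue_system_ex p_prime QpP vP.
apply: (exp_integral_decay vV natr_ext_neq0 w1 AP A_card
  (compact_val_ring p_prime QpP vP) muP (unitary_std_char R) fh fnc ED phiP phiE).
exact: ltnW (residue_card_gt1 p_prime QpP vP).
Qed.

End ExponentialSums.

Theorem theorem6p5p1 (p : nat) (p_prime : prime p)
    (Qp : fieldType) (vp : Qp -> \bar int) (QpP : padic_numbers p vp)
    (K : fieldExtType Qp) (v : K -> \bar int) (vP : padic_valuation vp v)
    (R : realType) (n r : nat)
    (mu : {measure set (borel v n) -> \bar R}) (muP : haar_measure mu) :
  (forall f : 'I_r -> mpoly n (valued v), poly_dominant f ->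
   forall phi : 'rV[valued v]_n -> rat, schwartz_bruhat setT phi ->
   exists alpha c : R, [/\ alpha < 0, 0 < c &
     forall y : 'rV[valued v]_r,
       Normc.normc (exp_integral p vp mu setT phi (poly_map f) y)
         < c * decay alpha y])
  /\
  (forall f' : 'rV[valued v]_n -> 'rV[valued v]_r,
   (forall i : 'I_r, restricted_analytic (fun x => f' x 0 i)) ->
   analytic_dominant f' ->
   forall phi' : 'rV[valued v]_n -> rat, schwartz_bruhat (int_ball v n) phi' ->
   exists alpha c : R, [/\ alpha < 0, 0 < c &
     forall y : 'rV[valued v]_r,
       Normc.normc (exp_integral p vp mu (int_ball v n) phi' f' y)
         < c * decay alpha y]).
Proof.
have vV := padic_valuation_valuation vP.
have [w vw] := padic_valuation_onto vP.
have w1 : veq v 1 w by apply/eqP.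
split=> [f fdom phi phiP|f fan fdom phi phiP].
  have [E hE] := compact_bounded vV phiP.2.
  (* a polynomial map is its own approximation, after rescaling *)
  have fh : poly_approx w E (poly_map f : 'rV[valued v]_n -> 'rV[valued v]_r)
      (fun i _ => scale_mpoly (w ^- E) (f i : mpoly n K)).
    split=> [i N M _ m|i N x _]; first by rewrite subrr mcoeff0 vge0.
    rewrite mxE meval_scale_mpoly.
    have -> : (fun j => (\row_j (w ^- E * x j : valued v)) 0 j) = (fun j => w ^- E * x j).
      by apply/funext => j; rewrite mxE.
    by rewrite subrr vge0.
  apply: (exp_integral_decay_ext p_prime QpP vP muP w1 fh) => //.
  move=> u c /rV0Pn[i ui].
  have [|x xE neq] := @poly_dominant_nonconst _ _ vV w n r w1 f (- E%:Z) (fun i => u 0 i) c fdom.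
    by exists i.
  exists (\row_j (x j : valued v)); first by move=> j; rewrite mxE; exact: xE.
  apply: contra neq => /eqP <-; apply/eqP; apply: eq_bigr => k _.
  by rewrite mxE; congr (_ * meval _ _); apply/funext => j; rewrite mxE.
have /choice[h hh] := fun i => restricted_analytic_limit vV (fan i).
have big0 : big_ball v n 0 = int_ball v n by [].
have fh : poly_approx w 0 f h.
  split=> [i|i N x x0]; first exact: (hh i).1.
  have -> : (\row_j (w ^- 0 * x j : valued v)) = \row_j (x j : valued v).
    by apply/rowP => j; rewrite !mxE expr0 invr1 mul1r.
  exact: (hh i).2.
apply: (exp_integral_decay_ext p_prime QpP vP muP w1 fh) => //.
by move=> u c u0; rewrite big0; exact: (analytic_dominant_nonconst vV w1).
Qed.
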